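(* Let $\sigma>0$ and let $f=\sum_{n\in\mathbb N_0^d}a_{2n}(f)h_{2n}\in\mathcal H_{\flat_\sigma,even}(\mathbb R^d)$. Then $f|_{\mathbb R^d_+}\circ w\in\mathcal G_{\flat_\sigma}(\mathbb R^d_+)$, and $f|_{\mathbb R^d_+}\circ w=\sum_{n\in\mathbb N_0^d}b_nl_n$ with $\{b_n\}_{n\in\mathbb N_0^d}\in\ell_{\flat_\sigma}(\mathbb N_0^d)$ given by $$b_n=\frac{(-1)^{|n|}2^{|n|}}{\pi^{d/4}}\sum_{k\in\mathbb N_0^d}\binom{k-\mathbf{3/2}}{k}\frac{(-1)^{|k|}2^{|k|}(k+n)!\,a_{2(k+n)}(f)}{\sqrt{(2(k+n))!}},\quad n\in\mathbb N_0^d.$$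
   Context: $\mathbb R^d_+=(0,\infty)^d$; $w(x)=(\sqrt{x_1},\dots,\sqrt{x_d})$ for $x\in[0,\infty)^d$. Multi-indices: $|n|=\sum n_j$, $n!=\prod n_j!$, $2n=(2n_1,\dots,2n_d)$, $\mathbf{3/2}=(3/2,\dots,3/2)$, $\binom{\gamma}{m}=\prod_j\frac{\gamma_j(\gamma_j-1)\cdots(\gamma_j-m_j+1)}{m_j!}$. Laguerre functions $l_n(x)=\prod_jL_{n_j}(x_j)e^{-x_j/2}$ with $L_m(t)=\frac{e^t}{m!}\frac{d^m}{dt^m}(e^{-t}t^m)$; Hermite functions $h_n(x)=\prod_j(2^{n_j}n_j!\sqrt\pi)^{-1/2}e^{-x_j^2/2}H_{n_j}(x_j)$, $H_m(t)=(-1)^me^{t^2}\frac{d^m}{dt^m}e^{-t^2}$; Hermite coefficients $a_n(f)=\int_{\mathbb R^d}fh_n$. For $\tau>0$, $\ell_{\flat_\tau}(\mathbb N_0^d)$ is the set of complex sequences $\{a_n\}$ with $\sup_n|a_n|h^{|n|}n!^{1/(2\tau)}<\infty$ for some $h>0$. $\mathcal H_{\flat_\sigma}(\mathbb R^d)$ is the space of $\sum_na_nh_n$ with $\{a_n\}\in\ell_{\flat_\sigma}(\mathbb N_0^d)$, and $\mathcal H_{\flat_\sigma,even}(\mathbb R^d)$ its subspace of functions invariant under changing the sign of any single coordinate. $\mathcal G_{\flat_\sigma}(\mathbb R^d_+)$ is the space of functions $\sum_na_nl_n$ (absolutely convergent series) with $\{a_n\}\in\ell_{\flat_{\sigma/2}}(\mathbb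 N_0^d)$. *)

(* Defs.v *)
From HB Require Import structures.
From mathcomp Require Import all_boot all_order all_algebra.
From mathcomp Require Import all_classical all_reals all_analysis.
From mathcomp Require Import complex.
Import Order.TTheory GRing.Theory Num.Theory.
Import numFieldTopology.Exports numFieldNormedType.Exports.

Set Implicit Arguments.
Unset Strict Implicit.
Unset Printing Implicit Defensive.

Local Open Scope ring_scope.
Local Open Scope classical_set_scope.
Local Open Scope complex_scope.

(* The usual (norm) topology / normed structure on the complex numbers R[i]
   (copied from the generic one of numFieldTypes). *)
HB.instance Definition _ (R : rcfType) := PseudoPointedMetric.copy R[i] (R[i])^o.
HB.instance Definition _ (R : rcfType) := NormedModule.copy R[i] (R[i])^o.

Definition mindex (d : nat) := {ffun 'I_d -> nat}.

Definition mabs (d : nat) (n : mindex d) : nat := \sum_(j < d) n j.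
Definition mfact (d : nat) (n : mindex d) : nat := \prod_(j < d) (n j)`!.
Definition mdouble (d : nat) (n : mindex d) : mindex d := [ffun j => (n j).*2].
Definition madd (d : nat) (k n : mindex d) : mindex d := [ffun j => k j + n j].

Definition gbinom (R : realType) (g : R) (m : nat) : R :=
  (\prod_(i < m) (g - i%:R)) / (m`!)%:R.
Definition mbinom_k32 (R : realType) (d : nat) (k : mindex d) : R :=
  \prod_(j < d) gbinom ((k j)%:R - 3 / 2) (k j).

Definition msummable (R : realType) (d : nat) (u : mindex d -> R[i]) : Prop :=
  summable setT (fun n => (complex.Re `|u n|)%:E).

Definition box_sum (R : realType) (d : nat) (u : mindex d -> R[i]) (N : nat)
  : R[i] :=
  \sum_(n : {ffun 'I_d -> 'I_N}) u [ffun j => nat_of_ord (n j)].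

(* value of the series sum_{n in N_0^d} u_n (limit of the box partial sums;
   for absolutely summable families this is the unconditional sum) *)
Definition msum (R : realType) (d : nat) (u : mindex d -> R[i]) : R[i] :=
  lim (box_sum u @ \oo).

Definition msum_to (R : realType) (d : nat) (u : mindex d -> R[i]) (s : R[i])
  : Prop :=
  msummable u /\ box_sum u @ \oo --> s.

Definition hermite_poly (R : realType) (m : nat) (t : R) : R :=
  (-1) ^+ m * expR (t ^+ 2) * derive1n m (fun s : R => expR (- s ^+ 2)) t.

Definition hermite_fun (R : realType) (m : nat) (t : R) : R :=
  (Num.sqrt (2 ^+ m * (m`!)%:R * Num.sqrt pi))^-1
  * expR (- t ^+ 2 / 2) * hermite_poly m t.

Definition laguerre_poly (R : realType) (m : nat) (t : R) : R :=
  expR t / (m`!)%:R * derive1n m (fun s : R => expR (- s) * s ^+ m) t.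

Definition laguerre_fun (R : realType) (m : nat) (t : R) : R :=
  laguerre_poly m t * expR (- t / 2).

Notation "R ^^ d" := ('I_d -> R) (at level 30, only parsing).

Definition hermite_d (R : realType) (d : nat) (n : mindex d) (x : 'I_d -> R)
  : R := \prod_(j < d) hermite_fun (n j) (x j).

Definition laguerre_d (R : realType) (d : nat) (n : mindex d) (x : 'I_d -> R)
  : R := \prod_(j < d) laguerre_fun (n j) (x j).

Definition cintegral (R : realType) (g : R -> R[i]) : R[i] :=
  Complex (Rintegral lebesgue_measure setT (fun t => complex.Re (g t)))
          (Rintegral lebesgue_measure setT (fun t => complex.Im (g t))).

Definition xcons (R : realType) (d : nat) (t : R) (y : 'I_d -> R)
  : 'I_d.+1 -> R :=
  fun i => if unlift ord0 i is Some j then y j else t.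

Fixpoint integral_Rd (R : realType) (d : nat) : (('I_d -> R) -> R[i]) -> R[i] :=
  match d with
  | 0 => fun g => g (fun _ => 0)
  | d'.+1 => fun g => cintegral (fun t => integral_Rd (fun y => g (xcons t y)))
  end.

Definition hermite_coef (R : realType) (d : nat) (f : ('I_d -> R) -> R[i])
  (n : mindex d) : R[i] :=
  integral_Rd (fun x => f x * (hermite_d n x)%:C).

Definition lflat (R : realType) (d : nat) (tau : R) (a : mindex d -> R[i])
  : Prop :=
  exists h : R, 0 < h /\
    exists M : R, forall n : mindex d,
      complex.Re `|a n| * h ^+ mabs n * ((mfact n)%:R `^ (2 * tau)^-1) <= M.

Definition Hflat (R : realType) (d : nat) (sigma : R) (f : ('I_d -> R) -> R[i])
  : Prop :=
  exists a : mindex d -> R[i], lflat sigma a /\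
    forall x : 'I_d -> R, msum_to (fun n => a n * (hermite_d n x)%:C) (f x).

Definition even_in_each (R : realType) (d : nat) (f : ('I_d -> R) -> R[i])
  : Prop :=
  forall (j : 'I_d) (x : 'I_d -> R),
    f (fun i => if i == j then - x i else x i) = f x.

Definition Hflat_even (R : realType) (d : nat) (sigma : R)
  (f : ('I_d -> R) -> R[i]) : Prop :=
  Hflat sigma f /\ even_in_each f.

Definition pos_orthant {R : realType} {d : nat} : set ('I_d -> R) :=
  [set x | forall j, 0 < x j].

Definition Gflat (R : realType) (d : nat) (sigma : R) (g : ('I_d -> R) -> R[i])
  : Prop :=
  exists b : mindex d -> R[i], lflat (sigma / 2) b /\
    forall x, pos_orthant x ->
      msum_to (fun n => b n * (laguerre_d n x)%:C) (g x).

Definition wmap (R : realType) (d : nat) (x : 'I_d -> R) : 'I_d -> R :=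
  fun j => Num.sqrt (x j).

Definition bterm (R : realType) (d : nat) (f : ('I_d -> R) -> R[i])
  (n k : mindex d) : R[i] :=
  (mbinom_k32 R k * (-1) ^+ mabs k * 2 ^+ mabs k * (mfact (madd k n))%:R
     / Num.sqrt (mfact (mdouble (madd k n)))%:R)%:C
  * hermite_coef f (mdouble (madd k n)).

Definition bcoef (R : realType) (d : nat) (f : ('I_d -> R) -> R[i])
  (n : mindex d) : R[i] :=
  ((-1) ^+ mabs n * 2 ^+ mabs n / pi `^ (d%:R / 4))%:C * msum (bterm f n).

(* Main.v *)
(** For each [d], the Hermite functions are orthonormal (integration by parts
    against the Gaussian) and [|h_n(t)| <= 6 ^ n], so a Hermite series with rapidly
    decreasing coefficients converges uniformly and integrating it term by term,
    one variable at a time, recovers its coefficients.  Applied to the reflections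
    of an even [f], this uniqueness kills the coefficients with an odd index.

    In one variable, [H_2m(x) = (-1)^m 4^m m! L_m^(-1/2)(x^2)] and
    [L_m^(-1/2) = \sum_k binom(k - 3/2, k) L_(m-k)], which is Vandermonde's
    identity on coefficients.  Substituting the product of these expansions into
    [\sum_m a_2m h_2m(w(x))] and collecting the Laguerre functions gives [b_n];
    truncating all sums to boxes [{0, ..., N-1}^d], the rearrangement error is
    [O(2^-N)] by geometric domination. *)
Require Import Defs.
From HB Require Import structures.
From mathcomp Require Import all_boot all_order all_algebra.
From mathcomp Require Import all_classical all_reals all_analysis.
From mathcomp Require Import complex.
From mathcomp Require Import measurable_realfun finmap ring lra.
Import Order.TTheory GRing.Theory Num.Theory.
Import numFieldTopology.Exports numFieldNormedType.Exports.
Set Implicit Arguments.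
Unset Strict Implicit.
Local Open Scope ring_scope.

(** * Hermite and Laguerre polynomials *)

(** The estimates are deliberately crude, because factorial decay beats every geometric sequence:
    [lflat] is turned into a bound [M * r ^+ mabs n] with [r] chosen freely, and each fixed ratio is
    what the next step consumes. A Hermite function costs 6 per unit of index, a Laguerre function
    at a fixed point costs 2, and the ratio 1/4 must remain: one factor 1/2 pays for summing over
    the indices, the other gives the error 2^-N. Hence 12 = 2 * 6, 24 = 4 * 6 and 64 = 8 * 8.

    The hypothesis only provides some coefficients [a], while [bcoef] is built from iterated
    integrals, so [a] must be identified with [hermite_coef f]. The induction on the dimension
    follows the iterated integral, without exchanging integrals. The stronger weight required by
    [Gflat] comes from (2n)! >= (n!)^2: restricting to even indices doubles the exponent of n!. *)

Fixpoint hermiteP {R : nzRingType} (m : nat) : {poly R} :=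
  if m is m'.+1 then 'X *+ 2 * hermiteP m' - (hermiteP m')^`() else 1.

Lemma hermitePS (R : nzRingType) m :
  hermiteP m.+1 = 'X *+ 2 * hermiteP m - (hermiteP m)^`() :> {poly R}.
Proof. by []. Qed.

(** Differentiating the recursion gives 2 H_(m+1) + 2X H_(m+1)' - H_(m+1)''. By induction the last
    two terms are 2(m+1) (2X H_m - H_m'), which is the recursion again. *)
Lemma deriv_hermiteP (R : comNzRingType) m :
  (hermiteP m.+1)^`() = hermiteP m *+ (m.+1).*2 :> {poly R}.
Proof.
elim: m => [|m IH].
  by rewrite /= mulr1 -polyC1 derivC subr0 derivMn derivX.
rewrite hermitePS derivB derivM derivMn derivX IH derivMn.
rewrite mulrnAr -addrA -mulrnBl -hermitePS doubleS mulr2n mulrDl mul1r.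
by rewrite !mulrS; ring.
Qed.

Lemma hermitePSS (R : comNzRingType) m :
  hermiteP m.+2 = 'X *+ 2 * hermiteP m.+1 - hermiteP m *+ (m.+1).*2 :> {poly R}.
Proof. by rewrite hermitePS deriv_hermiteP. Qed.

Lemma coef_hermitePSS0 (R : comNzRingType) m :
  (hermiteP m.+2 : {poly R})`_0 = - (hermiteP m)`_0 *+ (m.+1).*2.
Proof.
by rewrite hermitePSS coefB mulrnAl !coefMn coefXM eqxx mul0rn sub0r mulNrn.
Qed.

(** * Explicit coefficients and the Hermite-Laguerre identity *)

Section CharZero.
Variable R : numFieldType.
Implicit Types (p : {poly R}) (i j k m n : nat).
Local Notation hermiteP := (@hermiteP R).

Lemma coef_hermitePS m j :
  (hermiteP m.+1)`_j.+1 = 2 * m.+1%:R / j.+1%:R * (hermiteP m)`_j.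
Proof.
have /(congr1 (fun p : {poly R} => p`_j)) := deriv_hermiteP R m.
rewrite coef_deriv coefMn => /eqP.
move: (_`_j.+1) (_`_j) => u v.
rewrite -[u *+ _]mulr_natr -[v *+ _]mulr_natr -muln2 natrM => /eqP e.
have j0 : j.+1%:R != 0 :> R by rewrite pnatr_eq0.
by apply: (mulIf j0); rewrite e [RHS]mulrAC divfK //; ring.
Qed.

(** [coef_hermitePS] raises the index and the exponent together, so only constant terms remain;
    these follow from the three-term recurrence. *)
Lemma coef_hermiteP_even j k :
  (hermiteP (j + k.*2))`_j
  = (-1) ^+ k * (j + k.*2)`!%:R * 2 ^+ j / (k`!%:R * j`!%:R).
Proof.
have fn0 n : n`!%:R != 0 :> R by rewrite pnatr_eq0 -lt0n fact_gt0.
elim: j => [|j IH].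
  rewrite add0n; elim: k => [|k IH]; first by rewrite /= coef1 eqxx fact0 !expr0 !mul1r invr1.
  rewrite doubleS coef_hermitePSS0 -[LHS]mulr_natr IH !factS exprS expr0 fact0.
  rewrite -!muln2 !natrM -!natr1 !natrM.
  have := fn0 k; have : k%:R + 1 != 0 :> R by rewrite natr1 pnatr_eq0.
  by move=> h1 h2; field; rewrite h1 h2.
rewrite addSn coef_hermitePS IH !factS !natrM exprS.
have j0 : j%:R + 1 != 0 :> R by rewrite natr1 pnatr_eq0.
rewrite -!natr1; have := fn0 j; have := fn0 k => h1 h2.
by field; rewrite h1 h2 j0.
Qed.

Lemma coef_hermiteP_odd j k : (hermiteP (j + k.*2.+1))`_j = 0.
Proof.
elim: j => [|j IH]; last by rewrite addSn coef_hermitePS IH mulr0.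
rewrite add0n; elim: k => [|k IH]; last first.
  by rewrite doubleS coef_hermitePSS0 IH oppr0 mul0rn.
by rewrite /= mulr1 -polyC1 derivC subr0 coefMn coefX mul0rn.
Qed.

Lemma coef_hermiteP_gt m j : (m < j)%N -> (hermiteP m)`_j = 0.
Proof.
elim: m j => [|m IH] [|j] // mj; first by rewrite /= coef1.
by rewrite coef_hermitePS IH ?mulr0.
Qed.

Definition laguerreP n : {poly R} :=
  \poly_(i < n.+1) ('C(n, i)%:R * (-1) ^+ i / i`!%:R).

Lemma coef_laguerreP n i :
  (laguerreP n)`_i = 'C(n, i)%:R * (-1) ^+ i / i`!%:R.
Proof.
rewrite coef_poly ltnS; case: leqP => // ni.
by rewrite bin_small// !mul0r.
Qed.

(* [half_binom k] is the binomial coefficient (k - 3/2 choose k), i.e. the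
   [k]-th Taylor coefficient of [(1 - z)^(1/2)]. *)
Definition half_binom k : R :=
  (\prod_(i < k) (k%:R - 3 / 2 - i%:R)) / k`!%:R.

Lemma half_binom0 : half_binom 0 = 1.
Proof. by rewrite /half_binom big_ord0 fact0 divr1. Qed.

Lemma half_binomS k : half_binom k.+1 = half_binom k * (k%:R - 1 / 2) / k.+1%:R.
Proof.
rewrite /half_binom big_ord_recl factS natrM.
have -> : \prod_(i < k) (k.+1%:R - 3 / 2 - (lift ord0 i)%:R)
  = \prod_(i < k) (k%:R - 3 / 2 - i%:R) :> R.
  by apply: eq_bigr => i _; rewrite lift0 -!natr1; ring.
have h1 : k`!%:R != 0 :> R by rewrite pnatr_eq0 -lt0n fact_gt0.
have h2 : k.+1%:R != 0 :> R by rewrite pnatr_eq0.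
rewrite subr0 -[k.+1%:R]natr1 in h2 *.
by field; rewrite h1 h2.
Qed.

(* The binomial coefficient (i + e - 1/2 choose e). *)
Let half_ratio e i : R :=
  (i + e).*2`!%:R * i`!%:R / (4 ^+ e * (i + e)`!%:R * e`!%:R * i.*2`!%:R).

Let fn0 n : n`!%:R != 0 :> R. Proof. by rewrite pnatr_eq0 -lt0n fact_gt0. Qed.
Let Sn0 n : n%:R + 1 != 0 :> R. Proof. by rewrite natr1 pnatr_eq0. Qed.

Let factR n : n.+1`!%:R = (n%:R + 1) * n`!%:R :> R.
Proof. by rewrite factS natrM natr1. Qed.

Let fact2R n :
  n.+1.*2`!%:R = 2 * (n%:R + 1) * (2 * n%:R + 1) * n.*2`!%:R :> R.
Proof.
rewrite doubleS !factR -natr1 -[in n.*2%:R]mul2n natrM; ring.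
Qed.

Let Dn0 n : 2 * n%:R + 1 != 0 :> R.
Proof. by rewrite -natrM natr1 pnatr_eq0. Qed.

Let half_ratioSn e :
  half_ratio e.+1 0 = half_ratio e 0 * (2 * e%:R + 1) / (2 * (e%:R + 1)).
Proof.
rewrite /half_ratio !add0n double0 !fact0 fact2R factR exprS.
have := fn0 e; have := Sn0 e => h1 h2.
by field; rewrite h1 h2 expf_neq0 ?pnatr_eq0.
Qed.

(** [half_ratio e 0] is a Taylor coefficient of (1 - z)^(-1/2), which is -2 times the derivative of
    (1 - z)^(1/2). *)
Let half_binom_ratio e :
  half_binom e.+1 = - half_ratio e 0 / (2 * (e%:R + 1)).
Proof.
elim: e => [|e IH].
  by rewrite half_binomS half_binom0 /half_ratio add0n double0 fact0 expr0; field.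
rewrite half_binomS IH half_ratioSn -[e.+1%:R]natr1 -[e.+2%:R]natr1.
have := Sn0 e; have := Sn0 e.+1; rewrite -[e.+1%:R]natr1 => h1 h2.
by field; rewrite h1 h2.
Qed.

(** As [half_ratio e i] is the coefficient of z^e in (1 - z)^(-i-1/2), this is multiplication of (1
    - z)^(-i-3/2) by 1 - z. *)
Let half_ratio_pascal e i :
  half_ratio e.+1 i.+1 = half_ratio e.+1 i + half_ratio e i.+1.
Proof.
rewrite /half_ratio !addSn !addnS !fact2R !factR -[(i + e).+1%:R]natr1 natrD exprS.
have := fn0 e; have := fn0 i; have := fn0 (i + e); have := fn0 i.*2.
have := Sn0 e; have := Sn0 i; have := Sn0 (i + e); have := Dn0 i.
have := Sn0 (i + e).+1; rewrite -[(i + e).+1%:R]natr1 natrD.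
move=> h1 h2 h3 h4 h5 h6 h7 h8 h9.
by field; rewrite ?(h1, h2, h3, h4, h5, h6, h7, h8, h9) ?expf_neq0 ?pnatr_eq0.
Qed.

Let half_ratio0 i : half_ratio 0 i = 1.
Proof.
rewrite /half_ratio addn0 fact0 expr0.
by have := fn0 i; have := fn0 i.*2 => h1 h2; field; rewrite h1 h2.
Qed.

(** The coefficient of z^n in the product of (1 - z)^(1/2) and z^i / (1 - z)^(i+1), that is, in z^i
    (1 - z)^(-i-1/2); this predicts [half_sumE]. *)
Let half_sum n i := \sum_(k < n.+1) half_binom k * 'C(n - k, i)%:R.

Let half_sum0S n : half_sum n.+1 0 = half_sum n 0 + half_binom n.+1.
Proof.
rewrite /half_sum big_ord_recr /= bin0 mulr1; congr (_ + _).
by apply: eq_bigr => k _; rewrite !bin0.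
Qed.

Let half_sumSS n i : half_sum n.+1 i.+1 = half_sum n i + half_sum n i.+1.
Proof.
rewrite /half_sum big_ord_recr /= subnn bin0n mulr0 addr0 -big_split /=.
apply: eq_bigr => k _; rewrite subSn; last exact: ltn_ord k.
by rewrite binS natrD; ring.
Qed.

Let half_sum_gt n i : (n < i)%N -> half_sum n i = 0.
Proof.
move=> ni; apply: big1 => k _; rewrite bin_small ?mulr0//.
by rewrite (leq_ltn_trans _ ni)// leq_subr.
Qed.

(** Vandermonde's identity: both sides obey the same Pascal rule and agree on the edges [i = 0] and
    [e = 0]. *)
Let half_sumE e i : half_sum (i + e) i = half_ratio e i.
Proof.
move: {2}(i + e)%N (leqnn (i + e)%N) => n; elim: n e i => [|n IH] e i.
  rewrite leqn0 addn_eq0 => /andP[/eqP -> /eqP ->].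
  by rewrite /half_sum big_ord_recl big_ord0 half_binom0 half_ratio0 mul1r addr0.
case: i => [|i].
  case: e => [|e]; first by move=> _; apply: IH.
  rewrite !add0n => le; rewrite half_sum0S -[e in half_sum e]add0n IH//.
  rewrite half_binom_ratio half_ratioSn; have := Sn0 e => h.
  by field; rewrite h.
case: e => [|e].
  rewrite addn0 => le; rewrite half_sumSS -[i in half_sum i]addn0 IH ?addn0//.
  by rewrite half_sum_gt// !half_ratio0 addr0.
rewrite addSn => le; rewrite half_sumSS IH// half_ratio_pascal addnS -addSn IH//.
by rewrite addSn -addnS.
Qed.

(** Compared coefficientwise: the odd ones vanish on both sides, and the coefficient of X^(2i) on
    the right contains [half_sum n i]. *)
Lemma hermiteP_laguerreP n :
  hermiteP n.*2 = ((-1) ^+ n * 4 ^+ n * n`!%:R) *: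
   ((\sum_(k < n.+1) half_binom k *: laguerreP (n - k)) \Po 'X^2).
Proof.
apply/polyP => j; rewrite coefZ coef_comp_poly_Xn// dvdn2.
case: (boolP (odd j)) => oj /=.
  rewrite mulr0; have [/coef_hermiteP_gt //|] := ltnP n.*2 j.
  move=> jn; have o : odd (n.*2 - j) by rewrite oddB// odd_double oj.
  by rewrite -(subnKC jn) -[(_ - _)%N]odd_double_half o add1n coef_hermiteP_odd.
move: oj => /even_halfK <-; set i := j./2.
rewrite divn2 doubleK coef_sum.
under eq_bigr do rewrite coefZ coef_laguerreP mulrA mulrA.
rewrite -mulr_suml -mulr_suml -/(half_sum n i).
have [ni|ni] := ltnP n i.
  by rewrite half_sum_gt// !mul0r mulr0 coef_hermiteP_gt// ltn_double.
rewrite -(subnKC ni); move: (n - i)%N => e.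
rewrite doubleD coef_hermiteP_even half_sumE /half_ratio -doubleD exprD.
rewrite -[in 2 ^+ _]mul2n exprM (_ : 2 ^+ 2 = 4 :> R); last by ring.
rewrite exprD.
have s1 k : (-1) ^+ k * (-1) ^+ k = 1 :> R by rewrite -expr2 sqrr_sign.
have := fn0 e; have := fn0 i; have := fn0 (i + e); have := fn0 i.*2 => h1 h2 h3 h4.
transitivity ((-1) ^+ e * ((-1) ^+ i * (-1) ^+ i) *
  (i + e).*2`!%:R * 4 ^+ i / (e`!%:R * i.*2`!%:R) : R); first by rewrite s1 mulr1.
by field; rewrite ?(h1,h2,h3,h4) ?expf_neq0 ?pnatr_eq0.
Qed.

End CharZero.

(** * Rodrigues formulas *)

Section Rodrigues.
Variable R : realType.
Implicit Types (p : {poly R}) (t : R) (m n : nat).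

(** Iterated, this gives the Rodrigues formula; integrated, it gives [gauss_int_stein]. *)
Lemma is_derive_poly_gauss p t :
  is_derive t 1 (fun s => p.[s] * expR (- s ^+ 2))
    ((p^`() - 'X *+ 2 * p).[t] * expR (- t ^+ 2)).
Proof.
have h1 : is_derive t 1 (fun s : R => - s ^+ 2) (- (t *+ 2)).
  apply: is_derive_eq.
  by rewrite -mulr2n scaler1.
have h2 : is_derive t 1 (fun s => expR (- s ^+ 2)) (- (t *+ 2) * expR (- t ^+ 2)).
  have := @is_derive1_comp R expR (fun s : R => - s ^+ 2) t _ _ (is_derive_expR _) h1.
  by rewrite mulrC.
have h3 := @is_deriveM _ _ _ _ t 1 _ _ (is_derive_poly p t) h2.
apply: (is_derive_eq h3).
rewrite !hornerE /GRing.scale /=; ring.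
Qed.

Lemma derive1n_gauss m t :
  derive1n m (fun s : R => expR (- s ^+ 2)) t
  = (-1) ^+ m * (hermiteP m).[t] * expR (- t ^+ 2).
Proof.
elim: m t => [|m IH] t; first by rewrite derive1n0 /= !hornerE ?mul1r.
rewrite derive1nS derive1E.
have -> : derive1n m (fun s : R => expR (- s ^+ 2)) =
  (fun s => ((-1) ^+ m *: hermiteP m).[s] * expR (- s ^+ 2)).
  by apply/funext => s; rewrite IH hornerZ.
rewrite (@derive_val _ _ _ _ _ _ _ (is_derive_poly_gauss _ _)).
congr (_ * _); rewrite hermitePS derivZ -scalerAr -scalerBr !hornerZ exprS.
by rewrite mulN1r mulNr -mulrN -hornerN opprB.
Qed.

Lemma hermite_polyE m t : hermite_poly m t = (hermiteP m).[t].
Proof.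
rewrite /hermite_poly derive1n_gauss.
have h1 : expR (t ^+ 2) * expR (- t ^+ 2) = 1 by rewrite -expRD addrN expR0.
have h2 : (-1) ^+ m * (-1) ^+ m = 1 :> R by rewrite -expr2 sqrr_sign.
transitivity (((-1) ^+ m * (-1) ^+ m) * (expR (t ^+ 2) * expR (- t ^+ 2)) * (hermiteP m).[t]).
  by ring.
by rewrite h1 h2 !mul1r.
Qed.

Lemma is_derive_expN_poly p t :
  is_derive t 1 (fun s => expR (- s) * p.[s])
    (expR (- t) * (p^`() - p).[t]).
Proof.
have h2 : is_derive t 1 (fun s : R => expR (- s)) (- expR (- t)).
  have := @is_derive1_comp R expR -%R t _ _ (is_derive_expR _) (is_deriveNid _ _).
  by rewrite mulrN1.
have h3 := @is_deriveM _ _ _ _ t 1 _ _ h2 (is_derive_poly p t).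
apply: (is_derive_eq h3).
rewrite !hornerE /GRing.scale /=; ring.
Qed.

Lemma derive1n_expN_poly m p t :
  derive1n m (fun s : R => expR (- s) * p.[s]) t
  = expR (- t) * (iter m (fun q => q^`() - q) p).[t].
Proof.
elim: m t => [|m IH] t; first by rewrite derive1n0.
rewrite derive1nS derive1E (_ : derive1n m _ =
  fun s => expR (- s) * (iter m (fun q => q^`() - q) p).[s]); last exact/funext.
by rewrite (@derive_val _ _ _ _ _ _ _ (is_derive_expN_poly _ _)).
Qed.

(** Binomial expansion of (D - 1)^n applied to X^m. The exponent [n + (m - i)] has the parity of n -
    (m - i) and stays meaningful for m - i > n, where the binomial coefficient is zero. *)
Lemma coef_iter_derivB1 m n i :
  (iter n (fun q : {poly R} => q^`() - q) 'X^m)`_i =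
  if (i <= m)%N then (-1) ^+ (n + (m - i)) * 'C(n, m - i)%:R * m`!%:R / i`!%:R
  else 0.
Proof.
have fn0 k : k`!%:R != 0 :> R by rewrite pnatr_eq0 -lt0n fact_gt0.
elim: n i => [|n IH] i /=.
  rewrite coefXn; case: ltngtP => // [im|->].
    by rewrite bin0n subn_eq0 leqNgt im mulr0 !mul0r.
  by rewrite subnn bin0 !expr0 !mul1r divff.
rewrite coefB coef_deriv !IH; case: (ltngtP i m) => [im||->].
- rewrite -(subnKC im); move: (m - i.+1)%N => k.
  rewrite addKn addSnnS addKn -addSnnS binS natrD factS natrM -mulr_natr.
  rewrite !addSn !addnS !exprS.
  have := fn0 i; have : i.+1%:R != 0 :> R by rewrite pnatr_eq0.
  by rewrite -natr1 => h1 h2; field; rewrite h1 h2.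
- by rewrite mul0rn subr0.
- by rewrite subnn mul0rn addn0 !bin0 addn0 exprS; ring.
Qed.

Lemma laguerre_polyE m t : laguerre_poly m t = (laguerreP R m).[t].
Proof.
rewrite /laguerre_poly.
have -> : (fun s : R => expR (- s) * s ^+ m) = (fun s => expR (- s) * ('X^m).[s]).
  by apply/funext => s; rewrite hornerXn.
rewrite derive1n_expN_poly; set q := iter _ _ _.
have e1 : expR t * expR (- t) = 1 by rewrite -expRD addrN expR0.
transitivity (expR t * expR (- t) * (m`!%:R^-1 * q.[t])); first by ring.
rewrite e1 mul1r -hornerZ {}/q.
congr (_.[_]); apply/polyP => i; rewrite coefZ coef_iter_derivB1 coef_laguerreP.
have fn0 k : k`!%:R != 0 :> R by rewrite pnatr_eq0 -lt0n fact_gt0.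
case: leqP => im; last by rewrite bin_small// mulr0 !mul0r.
rewrite bin_sub//.
have -> : (-1) ^+ (m + (m - i)) = (-1) ^+ i :> R.
  by rewrite -signr_odd oddD oddB// addbA addbb signr_odd.
by field; rewrite !fn0.
Qed.

End Rodrigues.

(** * Orthonormality and bounds of the Hermite functions *)

Local Open Scope classical_set_scope.

Section GaussFunctional.
Variable R : realType.
Implicit Types (p q : {poly R}) (t x : R) (m n : nat).
Local Notation mu := (@lebesgue_measure R).

Lemma exprn_le_expR x n : 0 <= x -> x ^+ n <= n`!%:R * expR x.
Proof.
move=> x0; case: n => [|n]; first by rewrite expr0 fact0 mul1r (le_trans _ (expR_ge1Dx _))// lerDl.
have h := expR_ge1Dxn n x0; have f0 : 0 < n.+1`!%:R :> R by rewrite ltr0n fact_gt0.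
by rewrite mulrC -ler_pdivrMr//; apply: (le_trans _ h); rewrite lerDr.
Qed.

Lemma horner_le_gauss p :
  exists2 C, 0 <= C & forall x, `|p.[x]| <= C * expR (x ^+ 2 / 4).
Proof.
(* The factor [expR 1] comes from |x| <= 1 + x^2 / 4, that is, (|x| / 2 - 1)^2 >= 0. *)
exists (\sum_(i < size p) `|p`_i| * (i`!%:R * expR 1)).
  by apply: sumr_ge0 => i _; rewrite !mulr_ge0 ?expR_ge0.
move=> x; rewrite horner_coef mulr_suml (le_trans (ler_norm_sum _ _ _))//.
apply: ler_sum => i _; rewrite normrM normrX -mulrA ler_wpM2l//.
rewrite (le_trans (exprn_le_expR _ (normr_ge0 _)))// -mulrA ler_wpM2l//.
rewrite -expRD ler_expR -(real_normK (num_real x)).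
by have := sqr_ge0 (`|x| / 2 - 1); rewrite sqrrB1 exprMn exprVn => h; lra.
Qed.

Lemma horner_gauss_bound p :
  exists2 C, 0 <= C &
    forall x, `|p.[x] * gauss_fun x| <= C * expR (- (x ^+ 2 / 4)).
Proof.
have [C C0 hC] := horner_le_gauss p; exists C => // x.
rewrite normrM (ger0_norm (gauss_fun_ge0 _)) /gauss_fun.
apply: (@le_trans _ _ (C * expR (x ^+ 2 / 4) * expR (- x ^+ 2))).
  by rewrite ler_wpM2r// expR_ge0.
by rewrite -mulrA -expRD ler_wpM2l// ler_expR; have := sqr_ge0 x; lra.
Qed.

Lemma integrable_gauss4 : mu.-integrable setT
  (EFin \o (fun x => expR (- (x ^+ 2 / 4)))).
Proof.
(* The normal density of mean 0 and variance 2 is a multiple of exp(-x^2 / 4). *)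
have := integrable_normal_pdf (0 : R) (Num.sqrt 2).
have s0 : Num.sqrt 2 != 0 :> R by rewrite gt_eqF// sqrtr_gt0.
move=> /(integrableZl measurableT (normal_peak (Num.sqrt 2))^-1).
apply: eq_integrable => // x _ /=; rewrite normal_pdfE//.
rewrite /normal_fun -EFinM mulrA mulVf ?mul1r; last first.
  by rewrite gt_eqF// normal_peak_gt0.
by rewrite subr0 sqr_sqrtr// mulNr -mulrnA.
Qed.

Lemma continuous_horner_gauss p : continuous (fun x => p.[x] * gauss_fun x).
Proof.
move=> x; apply: (@cvgM _ _ (nbhs x) _ (horner p) (@gauss_fun R)).
  exact: continuous_horner.
exact: continuous_gauss_fun.
Qed.

Lemma measurable_horner_gauss p :
  measurable_fun setT (fun x => p.[x] * gauss_fun x).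
Proof. apply: continuous_measurable_fun; exact: continuous_horner_gauss. Qed.

Lemma integrable_horner_gauss p :
  mu.-integrable setT (EFin \o (fun x => p.[x] * gauss_fun x)).
Proof.
have [C C0 hC] := horner_gauss_bound p.
have := integrableZl measurableT C integrable_gauss4.
apply: le_integrable => //.
  by apply/measurable_EFinP; exact: measurable_horner_gauss.
move=> x _ /=; rewrite lee_fin; apply: (le_trans (hC x)).
exact: ler_norm.
Qed.

(** A linear functional on polynomials: orthogonality becomes algebra once its value at 1 and
    [gauss_int_stein] are known. *)
Definition gauss_int p : R := \int[mu]_x (p.[x] * gauss_fun x).

Lemma gauss_intD p q : gauss_int (p + q) = gauss_int p + gauss_int q.
Proof.
rewrite /gauss_int -RintegralD//; [|exact: integrable_horner_gauss..].
by apply: eq_Rintegral => x _; rewrite hornerD mulrDl.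
Qed.

Lemma gauss_intZ (c : R) p : gauss_int (c *: p) = c * gauss_int p.
Proof.
rewrite /gauss_int -RintegralZl//; last exact: integrable_horner_gauss.
by apply: eq_Rintegral => x _; rewrite hornerZ mulrA.
Qed.

Lemma gauss_int1 : gauss_int 1 = Num.sqrt pi.
Proof.
rewrite /gauss_int /Rintegral -[RHS]/(fine (Num.sqrt pi)%:E) -integralT_gauss.
by congr fine; apply: eq_integral => x _; rewrite hornerC mul1r.
Qed.

(** The integrand is the derivative of p times the Gaussian, so over a bounded interval only
    boundary values remain; dominated convergence passes to the whole line. *)
Lemma gauss_int_stein p : gauss_int (p^`() - 'X *+ 2 * p) = 0.
Proof.
set q := _ - _.
(* With [n.+1] the interval is nondegenerate also for [n = 0]. *)
pose g n x := ((fun x => (q.[x] * gauss_fun x)%:E) \_ `[- n.+1%:R, n.+1%:R]) x.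
pose f x := (q.[x] * gauss_fun x)%:E.
have iq := integrable_horner_gauss q.
have [_ _] : [/\ mu.-integrable setT f,
    [sequence \int[mu]_x `|g n x - f x|]_n @ \oo --> 0%E &
    [sequence \int[mu]_x g n x]_n @ \oo --> \int[mu]_x f x]%E.
  apply: (@dominated_convergence _ _ _ mu setT measurableT g f
    (abse \o f)).
  - move=> n; apply: (measurable_restrictT _ (measurable_itv _)).1.
    by apply: measurable_funTS; apply/measurable_EFinP; exact: measurable_horner_gauss.
  - by apply/measurable_EFinP; exact: measurable_horner_gauss.
  - apply: aeW => x _; apply: cvg_near_cst.
    near=> n; rewrite /g patchE mem_set//= in_itv/= -ler_norml.
    near: n; exists (Num.truncn `|x|) => // n /= nx.
    rewrite ltW// (lt_le_trans (truncnS_gt _))// ler_nat ltnS//.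
  - exact: integrable_abse.
  - apply: aeW => x n _; rewrite /g patchE; case: ifPn => // _.
    (* Outside the interval the restriction takes the default value [point], which is 0 here. *)
    by rewrite (_ : point = 0%E)// abse0 abse_ge0.
have [C C0 hC] := horner_gauss_bound p.
have int_g n : (\int[mu]_x g n x = ((p.[n.+1%:R] * gauss_fun n.+1%:R)
    - (p.[- n.+1%:R] * gauss_fun (- n.+1%:R)))%:E)%E.
  rewrite /g -integral_mkcond.
  rewrite (@continuous_FTC2 _ _ (fun x => p.[x] * gauss_fun x)) ?EFinB//.
  - by rewrite ltrNl (@lt_trans _ _ 0) ?oppr_lt0 ?ltr0n.
  - exact/continuous_subspaceT/continuous_horner_gauss.
  - split.
    + by move=> x _; have [] := is_derive_poly_gauss p x.
    + by apply: cvg_at_right_filter; exact: continuous_horner_gauss.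
    + by apply: cvg_at_left_filter; exact: continuous_horner_gauss.
  - move=> x _; rewrite derive1E.
    by rewrite (@derive_val _ _ _ _ _ _ _ (is_derive_poly_gauss p x)).
under eq_fun do rewrite int_g.
move=> h.
suff h0 : ((p.[n.+1%:R] * gauss_fun n.+1%:R)
    - (p.[- n.+1%:R] * gauss_fun (- n.+1%:R)))%:E @[n --> \oo] --> (0 : R)%:E.
  by rewrite /gauss_int /Rintegral (cvg_unique _ h h0).
apply: cvg_EFin; first by near=> n.
apply/norm_cvg0P.
(* From u <= 1 + u^2 / 4 <= exp(u^2 / 4); the boundary values are then O(1/n). *)
have exp_le (u : R) : 0 < u -> expR (- (u ^+ 2 / 4)) <= u^-1.
  move=> u0; rewrite expRN lef_pV2 ?posrE ?expR_gt0//.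
  apply: le_trans (expR_ge1Dx _).
  by have := sqr_ge0 (u / 2 - 1); rewrite sqrrB1 exprMn exprVn => h1; lra.
have hub n : `|p.[n.+1%:R] * gauss_fun n.+1%:R
    - (p.[- n.+1%:R] * gauss_fun (- n.+1%:R))| <= 2 * C * harmonic n.
  rewrite /harmonic /=; have n0 : 0 < n.+1%:R :> R by rewrite ltr0n.
  have h1 := hC n.+1%:R; have := hC (- n.+1%:R); rewrite sqrrN => h2.
  have h3 := ler_wpM2l C0 (exp_le _ n0).
  rewrite -mulrA mulr_natl mulr2n.
  by rewrite (le_trans (ler_normB _ _))// lerD// ?(le_trans h1) ?(le_trans h2).
apply: (@squeeze_cvgr _ _ _ _ (fun=> 0) (fun n => 2 * C * harmonic n)).
- by near=> n; rewrite normr_ge0 /=; exact: hub.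
- exact: cvg_cst.
- by rewrite -[X in _ --> X](mulr0 (2 * C)); apply: cvgMl_tmp; exact: cvg_harmonic.
Unshelve. all: end_near. Qed.

Definition hermite_sqnorm (m : nat) : R := 2 ^+ m * m`!%:R * Num.sqrt pi.

(** For the Gaussian weight, the raising operator 2X - d/dX is the adjoint of d/dX. *)
Lemma gauss_int_hermiteP m p : gauss_int (hermiteP m.+1 * p) = gauss_int (hermiteP m * p^`()).
Proof.
have := gauss_int_stein (hermiteP m * p); rewrite derivM => h.
have -> : hermiteP m.+1 * p = hermiteP m * p^`() +
   (-1) *: ((hermiteP m)^`() * p + hermiteP m * p^`() - 'X *+ 2 * (hermiteP m * p)).
  by rewrite hermitePS scaleN1r; ring.
by rewrite gauss_intD gauss_intZ h mulr0 addr0.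
Qed.

Lemma gauss_int_hermiteP2 m n :
  gauss_int (hermiteP m * hermiteP n) = if m == n then hermite_sqnorm m else 0.
Proof.
elim: m n => [|m IH] [|n].
- by rewrite mul1r gauss_int1 /hermite_sqnorm fact0 expr0 !mul1r.
- rewrite mulrC gauss_int_hermiteP /= -polyC1 derivC mulr0.
  by rewrite -(scale0r 0) gauss_intZ mul0r.
- rewrite gauss_int_hermiteP /= -polyC1 derivC mulr0.
  by rewrite -(scale0r 0) gauss_intZ mul0r.
- rewrite gauss_int_hermiteP deriv_hermiteP -scaler_nat -scalerAr gauss_intZ IH eqSS.
  case: eqP => [->|_]; last by rewrite mulr0.
  by rewrite /hermite_sqnorm exprS factS -mul2n !natrM; ring.
Qed.

Lemma hermite_sqnorm_gt0 m : 0 < hermite_sqnorm m.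
Proof.
by rewrite /hermite_sqnorm !mulr_gt0 ?exprn_gt0// ?ltr0n ?fact_gt0// sqrtr_gt0 pi_gt0.
Qed.

Lemma hermite_funE m t : hermite_fun m t =
  (Num.sqrt (hermite_sqnorm m))^-1 * ((hermiteP m).[t] * expR (- t ^+ 2 / 2)).
Proof. by rewrite /hermite_fun hermite_polyE -mulrA [_ * _.[_]]mulrC. Qed.

Lemma hermite_funM m n t : hermite_fun m t * hermite_fun n t =
  (Num.sqrt (hermite_sqnorm m) * Num.sqrt (hermite_sqnorm n))^-1 *
  ((hermiteP m * hermiteP n).[t] * gauss_fun t).
Proof.
rewrite !hermite_funE hornerM /gauss_fun invfM.
rewrite (_ : expR (- t ^+ 2) = expR (- t ^+ 2 / 2) * expR (- t ^+ 2 / 2)); last first.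
  by rewrite -expRD; congr expR; field.
by ring.
Qed.

Lemma continuous_hermite_fun m : continuous (@hermite_fun R m).
Proof.
move=> t.
have -> : @hermite_fun R m = (fun t =>
  (Num.sqrt (hermite_sqnorm m))^-1 * ((hermiteP m).[t] * expR (- t ^+ 2 / 2))).
  by apply/funext => x; rewrite hermite_funE.
apply: cvgMl_tmp; apply: cvgM; first exact: continuous_horner.
apply: continuous_comp; last exact: continuous_expR.
by apply: cvgMr_tmp; apply: cvgN; exact: exprn_continuous.
Qed.

Lemma measurable_hermite_fun m : measurable_fun setT (@hermite_fun R m).
Proof. apply: continuous_measurable_fun; exact: continuous_hermite_fun. Qed.

Lemma integrable_hermite_fun m : mu.-integrable setT (EFin \o @hermite_fun R m).
Proof.
have [C C0 hC] := horner_le_gauss (hermiteP m).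
have := integrableZl measurableT ((Num.sqrt (hermite_sqnorm m))^-1 * C) integrable_gauss4.
apply: le_integrable => //.
  by apply/measurable_EFinP; exact: measurable_hermite_fun.
move=> x _ /=; rewrite lee_fin hermite_funE !normrM -mulrA ler_wpM2l//.
rewrite (ger0_norm C0) !(ger0_norm (expR_ge0 _)).
apply: (@le_trans _ _ (C * expR (x ^+ 2 / 4) * expR (- x ^+ 2 / 2))).
  by rewrite ler_wpM2r// expR_ge0.
by rewrite -mulrA -expRD ler_wpM2l// ler_expR; have := sqr_ge0 x; lra.
Qed.

Lemma integrable_hermite_funM m n :
  mu.-integrable setT (EFin \o (fun t => hermite_fun m t * hermite_fun n t)).
Proof.
have := integrableZl measurableT ((Num.sqrt (hermite_sqnorm m) * Num.sqrt (hermite_sqnorm n))^-1)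
  (integrable_horner_gauss (hermiteP m * hermiteP n)).
by apply: eq_integrable => // x _ /=; rewrite hermite_funM EFinM.
Qed.

Lemma hermite_fun_orthonormal m n :
  \int[mu]_t (hermite_fun m t * hermite_fun n t) = (m == n)%:R.
Proof.
under eq_Rintegral do rewrite hermite_funM.
rewrite RintegralZl//; last exact: integrable_horner_gauss.
rewrite -/(gauss_int _) gauss_int_hermiteP2; case: eqP => [->|_]; last first.
  by rewrite mulr0.
rewrite -expr2 sqr_sqrtr ?ltW ?hermite_sqnorm_gt0// mulVf//.
by rewrite gt_eqF ?hermite_sqnorm_gt0.
Qed.

(** * Geometric bound on the Hermite functions *)

Let rfact k : R := Num.sqrt k`!%:R.
Let rfactS k : rfact k.+1 = Num.sqrt k.+1%:R * rfact k.
Proof. by rewrite /rfact factS natrM sqrtrM. Qed.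
Let rfact_gt0 k : 0 < rfact k.
Proof. by rewrite sqrtr_gt0 ltr0n fact_gt0. Qed.
Let normH m : R := Num.sqrt (2 ^+ m * m`!%:R).
Let normHS m : normH m.+1 = Num.sqrt 2 * Num.sqrt m.+1%:R * normH m.
Proof.
rewrite /normH exprS factS natrM -sqrtrM// -sqrtrM; last by rewrite mulr_ge0.
by congr Num.sqrt; ring.
Qed.
Let normH_gt0 m : 0 < normH m.
Proof. by rewrite sqrtr_gt0 mulr_gt0 ?exprn_gt0// ltr0n fact_gt0. Qed.
(** Each term is at most exp(t^2 / 2), because (t^2)^k / k! <= exp(t^2); the Gaussian factor of a
    Hermite function thus brings this sum down to at most m + 1. *)
Let majorant m t : R := \sum_(k < m.+1) `|t| ^+ k / rfact k.

Let majorantM m t : `|t| * majorant m t <= Num.sqrt m.+1%:R * majorant m.+1 t.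
Proof.
rewrite /majorant [in leRHS]big_ord_recl mulrDr !mulr_sumr.
apply: (@le_trans _ _ (\sum_(i < m.+1) Num.sqrt m.+1%:R *
   (`|t| ^+ (lift ord0 i) / rfact (lift ord0 i)))); last first.
  by rewrite lerDr mulr_ge0// mulr_ge0// invr_ge0 ltW.
apply: ler_sum => k _; rewrite lift0 rfactS invfM exprS.
have s0 : 0 < Num.sqrt k.+1%:R :> R by rewrite sqrtr_gt0.
have -> : Num.sqrt m.+1%:R * (`|t| * `|t| ^+ k * ((Num.sqrt k.+1%:R)^-1 / rfact k))
  = (`|t| * (`|t| ^+ k / rfact k)) * (Num.sqrt m.+1%:R / Num.sqrt k.+1%:R) by ring.
have v0 : 0 <= `|t| * (`|t| ^+ k / rfact k).
  by rewrite !mulr_ge0 ?exprn_ge0 ?invr_ge0// ltW.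
rewrite ler_peMr//.
by rewrite ler_pdivlMr// mul1r ler_sqrt// ler_nat.
Qed.

Let majorant_ge0 m t : 0 <= majorant m t.
Proof. by apply: sumr_ge0 => k _; rewrite mulr_ge0// invr_ge0 ltW. Qed.

Let majorant_le m t : majorant m t <= majorant m.+1 t.
Proof.
by rewrite /majorant [leRHS]big_ord_recr /= lerDl mulr_ge0// invr_ge0 ltW.
Qed.

Let hermiteP_le m t : `|(hermiteP m).[t]| <= normH m * 3 ^+ m * majorant m t.
Proof.
(* The recurrence has order two, so consecutive indices are treated together. *)
have [] : `|(hermiteP m).[t]| <= normH m * 3 ^+ m * majorant m t /\
  `|(hermiteP m.+1).[t]| <= normH m.+1 * 3 ^+ m.+1 * majorant m.+1 t; last by [].
have s2 : 1 <= Num.sqrt (2 : R) <= 2.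
  have := sqr_sqrtr (ler0n R 2); have := sqrtr_ge0 (2 : R).
  by move: (Num.sqrt 2) => u u0 u2; apply/andP; split; nra.
have H0 : normH 0 = 1 by rewrite /normH expr0 fact0 mulr1 sqrtr1.
have A0 : majorant 0 t = 1.
  by rewrite /majorant big_ord_recl big_ord0 /rfact fact0 sqrtr1 divr1 addr0.
elim: m => [|m [IH1 IH2]].
  split; first by rewrite H0 A0 expr0 !mul1r hornerC normr1.
  have := majorantM 0 t; have := majorant_ge0 1 t.
  rewrite A0 normHS H0 sqrtr1 hermitePS /= derivC subr0 mulr1 hornerMn hornerX.
  rewrite -mulr_natl normrM normr_nat mulr1 mul1r expr1 => h1 h2.
  nra.
split=> //; rewrite hermitePSS hornerD hornerN hornerM !hornerMn hornerX.
rewrite -mulr_natl -[_ *+ _.*2]mulr_natl -mul2n natrM.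
apply: (le_trans (ler_normB _ _)); rewrite !normrM !normr_nat.
rewrite [normH m.+2]normHS !exprS; rewrite exprS in IH2.
have := majorantM m.+1 t; have := majorant_le m t; have := majorant_le m.+1 t.
have := majorant_ge0 m t; have := normH_gt0 m; have := normH_gt0 m.+1.
have := normHS m.
have ab : Num.sqrt m.+1%:R <= Num.sqrt m.+2%:R :> R by rewrite ler_wsqrtr// ler_nat.
have a2 := sqr_sqrtr (ler0n R m.+1); have a0 := sqrtr_ge0 (m.+1%:R : R).
have E0 : 0 < 3 ^+ m :> R by rewrite exprn_gt0.
have q := sqr_sqrtr (ler0n R 2).
move: (majorant m t) (majorant m.+1 t) (majorant m.+2 t) IH1 IH2 a0 a2 ab q s2.
move: (normH m) (normH m.+1) (Num.sqrt m.+2%:R) (Num.sqrt m.+1%:R) (Num.sqrt 2).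
move: `|(hermiteP m).[t]| `|(hermiteP m.+1).[t]| (3 ^+ m) E0 (m.+1%:R).
move=> P P1 E E0 k H H1 b a s A A1 A2 IH1 IH2 a0 a2 ab q /andP[s1 _] H1E H1p Hp A_ge0 AA1 A12 tA.
have A2_ge0 : 0 <= A2 by lra.
have b0 : 0 <= b by lra.
have s0 : 0 <= s by lra.
have E1 := ltW E0; have H11 := ltW H1p; have H2 := ltW Hp.
(* In terms of Q = [E * H1 * s * b * A2], the two terms of the recurrence are at most 6 Q and Q,
   while the claimed bound is 9 Q; this is where the ratio 3 has room. *)
have T1 : `|t| * P1 <= 3 * E * H1 * (b * A2).
  apply: (@le_trans _ _ (`|t| * (H1 * (3 * E) * A1))); first by rewrite ler_wpM2l.
  rewrite (_ : `|t| * _ = 3 * E * H1 * (`|t| * A1)); last by ring.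
  by rewrite ler_wpM2l// !mulr_ge0 ?ltW.
have T2 : k * P <= E * H * (a * b * A2).
  apply: (@le_trans _ _ (k * (H * E * A))); first by rewrite ler_wpM2l// -a2 sqr_ge0.
  rewrite (_ : k * _ = E * H * (k * A)); last by ring.
  rewrite ler_wpM2l//; first by rewrite mulr_ge0 ?ltW.
  rewrite -a2 expr2.
  apply: ler_pM; rewrite ?mulr_ge0//; last lra.
  by rewrite ler_wpM2l.
have T3 : E * H * (a * b * A2) * 2 = E * H1 * s * b * A2.
  by rewrite H1E -q; ring.
have T4 : E * H1 * (b * A2) <= E * H1 * s * b * A2.
  rewrite (_ : E * H1 * s * b * A2 = s * (E * H1 * (b * A2))); last by ring.
  by rewrite ler_peMl// !mulr_ge0.
rewrite (_ : s * b * H1 * (3 * (3 * E)) * A2 = 9 * (E * H1 * s * b * A2)); last by ring.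
rewrite (_ : 3 * E * H1 * (b * A2) = 3 * (E * H1 * (b * A2))) in T1; last by ring.
have T5 : 0 <= E * H1 * s * b * A2 by rewrite !mulr_ge0.
move: T1 T2 T3 T4 T5; rewrite -[2 * `|t| * P1]mulrA -[2 * k * P]mulrA.
move: (E * H1 * s * b * A2) (`|t| * P1) (k * P) (E * H * (a * b * A2)) (E * H1 * (b * A2)) => x1 x2 x3 x4 x5.
lra.
Qed.

(** Here 6 = 3 * 2: the 3 comes from [hermiteP_le], the 2 from m + 1 <= 2^m for the number of terms
    of [majorant]. *)
Lemma hermite_fun_le m t : `|hermite_fun m t| <= 6 ^+ m.
Proof.
have pi1 : 1 <= Num.sqrt (Num.sqrt pi) :> R.
  rewrite -sqrtr1 ler_wsqrtr// -sqrtr1 ler_wsqrtr//.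
  by have := pi_ge2 R; lra.
have maj : majorant m t * expR (- t ^+ 2 / 2) <= m.+1%:R.
  rewrite /majorant mulr_suml -[m.+1 in leRHS]card_ord -sumr_const.
  apply: ler_sum => k _; rewrite mulNr expRN mulrAC ler_pdivrMr ?mul1r//.
  rewrite ler_pdivrMr ?expR_gt0//.
  rewrite -[leLHS]ger0_norm ?exprn_ge0// -sqrtr_sqr -exprM mulnC exprM.
  have -> : expR (t ^+ 2 / 2) = Num.sqrt (expR (t ^+ 2)).
    rewrite -[LHS]ger0_norm ?expR_ge0// -sqrtr_sqr; congr Num.sqrt.
    by rewrite expr2 -expRD; congr expR; field.
  rewrite -sqrtrM// ler_wsqrtr// real_normK ?num_real//.
  exact: exprn_le_expR (sqr_ge0 t).
rewrite hermite_funE /hermite_sqnorm sqrtrM ?mulr_ge0// -/(normH m) normrM.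
rewrite ger0_norm ?invr_ge0 ?mulr_ge0 ?sqrtr_ge0// normrM (ger0_norm (expR_ge0 _)).
rewrite mulrC ler_pdivrMr ?mulr_gt0// ?(lt_le_trans _ pi1)//.
apply: (@le_trans _ _ (normH m * 3 ^+ m * majorant m t * expR (- t ^+ 2 / 2))).
  by rewrite ler_wpM2r ?expR_ge0 ?hermiteP_le.
apply: (@le_trans _ _ (normH m * 3 ^+ m * 2 ^+ m)).
  rewrite -mulrA ler_wpM2l//; first by rewrite mulr_ge0 ?exprn_ge0 ?ltW.
  by apply: (le_trans maj); rewrite -natrX ler_nat ltn_expl.
rewrite (_ : 6 ^+ m = 3 ^+ m * 2 ^+ m :> R); last first.
  by rewrite -exprMn; congr (_ ^+ _); ring.
rewrite -mulrA [leLHS]mulrC ler_wpM2l ?mulr_ge0 ?exprn_ge0//.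
by rewrite ler_peMr// ltW.
Qed.

End GaussFunctional.

(** * Complex sequences and sums over boxes *)

Local Open Scope complex_scope.

Section ComplexModulus.
Variable R : realType.
Implicit Types (z w : R[i]) (x : R).

(** The norm of [R[i]] is itself complex-valued; its real part, the quantity in [lflat] and
    [msummable], lets estimates take place in [R]. *)
Definition modc z : R := complex.Re `|z|.

Lemma modcE z : (modc z)%:C = `|z|.
Proof. by rewrite /modc normc_def. Qed.

Lemma modc_ge0 z : 0 <= modc z.
Proof. by rewrite -ler0c modcE. Qed.

Lemma modc0 : modc 0 = 0.
Proof. by rewrite /modc normr0. Qed.

Lemma modcD z w : modc (z + w) <= modc z + modc w.
Proof. by rewrite -lecR rmorphD /= !modcE ler_normD. Qed.

Lemma modcN z : modc (- z) = modc z.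
Proof. by rewrite /modc normrN. Qed.

Lemma modcM z w : modc (z * w) = modc z * modc w.
Proof. by apply: complexI; rewrite rmorphM /= !modcE normrM. Qed.

Lemma modcR x : modc x%:C = `|x|.
Proof. by rewrite /modc normc_def /= expr0n addr0 sqrtr_sqr. Qed.

Lemma modc_sum (I : Type) (s : seq I) (P : pred I) (F : I -> R[i]) :
  modc (\sum_(i <- s | P i) F i) <= \sum_(i <- s | P i) modc (F i).
Proof.
elim/big_ind2 : _ => //; first by rewrite modc0.
by move=> z a w b za wb; rewrite (le_trans (modcD _ _))// lerD.
Qed.

Lemma Re_le_modc z : `|complex.Re z| <= modc z.
Proof. by rewrite -lecR modcE normc_ge_Re. Qed.

Lemma Im_le_modc z : `|complex.Im z| <= modc z.
Proof.
rewrite /modc normc_def /= -sqrtr_sqr ler_wsqrtr//.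
by rewrite lerDr sqr_ge0.
Qed.

Lemma modc_le_ReIm z : modc z <= `|complex.Re z| + `|complex.Im z|.
Proof.
case: z => a b /=; have -> : a +i* b = a%:C + 'i * b%:C by rewrite [LHS]complexE.
rewrite (le_trans (modcD _ _))// modcM !modcR.
by rewrite /modc normc_def /= expr0n expr1n add0r sqrtr1 mul1r.
Qed.

Lemma cvg_modcP (u : nat -> R[i]) z :
  u @ \oo --> z <-> forall e : R, 0 < e -> \forall n \near \oo, modc (z - u n) < e.
Proof.
split=> [/cvgrPdist_lt h e e0|h].
  by near=> n; rewrite -ltcR modcE; near: n; apply: h; rewrite ltcR.
apply/cvgrPdist_lt => -[e e'] /=; rewrite ltcE /= => /andP[/eqP -> e0].
by near=> n; rewrite -modcE -[e +i* 0]/(e%:C) ltcR; near: n; exact: h.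
Unshelve. all: end_near. Qed.

Lemma cvg_modc_le (u : nat -> R[i]) z w (e : R) :
  u @ \oo --> z -> (\forall n \near \oo, modc (u n - w) <= e) -> modc (z - w) <= e.
Proof.
move=> /cvg_modcP h hw; apply/ler_addgt0Pr => d d0.
have [n _ /(_ n (leqnn n)) [h1 h2]] := filterI hw (h _ d0).
have -> : z - w = (u n - w) + (z - u n) by ring.
by rewrite (le_trans (modcD _ _))// lerD// ltW.
Qed.

Lemma cvg_modc_unique (u : nat -> R[i]) z w :
  u @ \oo --> z -> u @ \oo --> w -> z = w.
Proof. by move=> h1 h2; apply: (@cvg_unique R[i]) h1 h2; exact: norm_hausdorff. Qed.

Lemma exp2V_cvg0 (C e : R) : 0 < e -> \forall n \near \oo, C * 2^-1 ^+ n < e.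
Proof.
move=> e0.
have : (fun n => C * 2^-1 ^+ n) @ \oo --> (0 : R).
  rewrite -[X in _ --> X](mulr0 C); apply: cvgMl_tmp.
  by apply: cvg_expr; rewrite ger0_norm; lra.
move=> /cvgrPdist_lt /(_ _ e0); apply: filterS => n.
by rewrite sub0r normrN; apply: le_lt_trans; exact: ler_norm.
Qed.

Lemma geo_tail (u : nat -> R[i]) (C : R) :
  (forall n, modc (u n.+1 - u n) <= C * 2^-1 ^+ n) ->
  forall n k, modc (u (n + k)%N - u n) <= 2 * C * 2^-1 ^+ n.
Proof.
move=> h n k; have C0 : 0 <= C by have := h 0; rewrite expr0 mulr1; apply: le_trans; exact: modc_ge0.
elim: k n => [|k IH] n.
  by rewrite addn0 subrr modc0 !mulr_ge0// exprn_ge0// invr_ge0.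
rewrite addnS -addSn.
have -> : u (n.+1 + k)%N - u n = (u (n.+1 + k)%N - u n.+1) + (u n.+1 - u n) by ring.
rewrite (le_trans (modcD _ _))// (le_trans (lerD (IH _) (h n)))// exprS.
by rewrite le_eqVlt; apply/orP; left; apply/eqP; field.
Qed.

Lemma geo_cvg (u : nat -> R[i]) (C : R) :
  (forall n, modc (u n.+1 - u n) <= C * 2^-1 ^+ n) ->
  exists2 z, u @ \oo --> z & forall n, modc (z - u n) <= 2 * C * 2^-1 ^+ n.
Proof.
move=> h; have ht := geo_tail h.
(* Here [f] is the real or the imaginary part; its telescoping series is dominated by a geometric
   one. *)
have cauchy (f : R[i] -> R) : (forall z w, f (z - w) = f z - f w) ->
    (forall z, `|f z| <= modc z) -> cvg ((f \o u) @ \oo).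
  move=> fB fle.
  have -> : f \o u = series (telescope (f \o u)) \+ cst (f (u 0)).
    by apply/funext => n; rewrite /= telescopeK /= addrNK.
  apply: is_cvgD; last exact: is_cvg_cst.
  apply: normed_cvg; apply: series_le_cvg (@is_cvg_geometric_series _ C 2^-1 _).
  - by move=> n /=; exact: normr_ge0.
  - by move=> n; rewrite /= mulr_ge0// ?exprn_ge0//; have := h 0; rewrite expr0 mulr1; apply: le_trans; exact: modc_ge0.
  - by move=> n; rewrite /= /telescope /= -fB (le_trans (fle _)).
  - by rewrite ger0_norm; lra.
have /cvg_ex[/= a ha] := cauchy (@complex.Re R) (fun z w => raddfB (@complex.Re R) z w) Re_le_modc.
have /cvg_ex[/= b hb] := cauchy (@complex.Im R) (fun z w => raddfB (@complex.Im R) z w) Im_le_modc.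
have hz : u @ \oo --> a +i* b.
  apply/cvg_modcP => e e0; have e2 : 0 < e / 2 by rewrite divr_gt0.
  have /cvgrPdist_lt/(_ _ e2) h1 := ha; have /cvgrPdist_lt/(_ _ e2) h2 := hb.
  near=> n; rewrite (le_lt_trans (modc_le_ReIm _))// !raddfB /= (splitr e) ltrD//.
  - by near: n.
  - by near: n.
exists (a +i* b) => // n; apply: (cvg_modc_le hz).
by exists n => // k /= nk; rewrite -(subnKC nk); exact: ht.
Unshelve. all: end_near. Qed.

End ComplexModulus.

(** * Sums over boxes and geometric domination *)

Section Boxes.
Variable R : realType.
Implicit Types (d N : nat) (M : R).

(** As sequences over the single type [mindex d], boxes of different sides can be compared by
    membership. *)
Definition box d N : seq (mindex d) :=
  [seq [ffun j => nat_of_ord (n j)] | n : {ffun 'I_d -> 'I_N}].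

Lemma box_sumE d (u : mindex d -> R[i]) N :
  box_sum u N = \sum_(n <- box d N) u n.
Proof. by rewrite /box_sum /box big_map big_enum. Qed.

Lemma mem_box d N (n : mindex d) : (n \in box d N) = [forall j, n j < N]%N.
Proof.
apply/mapP/forallP => [[m _ ->] j|h]; first by rewrite ffunE.
exists [ffun j => Ordinal (h j)]; first by rewrite mem_enum.
by apply/ffunP => j; rewrite !ffunE.
Qed.

Lemma box_uniq d N : uniq (box d N).
Proof.
rewrite map_inj_uniq ?enum_uniq// => m n /ffunP h.
by apply/ffunP => j; apply: val_inj; have := h j; rewrite !ffunE.
Qed.

Lemma notin_box d N (n : mindex d) : n \notin box d N -> (N <= mabs n)%N.
Proof.
rewrite mem_box => /forallPn[j]; rewrite -leqNgt => h.
by rewrite (leq_trans h)// /mabs (bigD1 j)//= leq_addr.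
Qed.

Lemma sum_box_prod (A : comNzRingType) d N (F : 'I_d -> nat -> A) :
  \sum_(n <- box d N) \prod_(j < d) F j (n j) = \prod_(j < d) \sum_(i < N) F j i.
Proof.
rewrite bigA_distr_bigA /box big_map big_enum; apply: eq_bigr => n _.
by apply: eq_bigr => j _; rewrite ffunE.
Qed.

Lemma exprn_mabs d (x : R) (n : mindex d) : x ^+ mabs n = \prod_(j < d) x ^+ n j.
Proof. by rewrite /mabs prodrXr. Qed.

Lemma sum_half_pow N : \sum_(i < N) 2^-1 ^+ i <= 2 :> R.
Proof.
suff -> : \sum_(i < N) 2^-1 ^+ i = 2 - 2 * 2^-1 ^+ N :> R.
  by rewrite gerBl mulr_ge0// exprn_ge0// invr_ge0.
elim: N => [|N IH]; first by rewrite big_ord0 expr0 mulr1 subrr.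
by rewrite big_ord_recr /= IH exprS; field.
Qed.

Lemma sum_box_geo d N : \sum_(n <- box d N) 2^-1 ^+ mabs n <= 2 ^+ d :> R.
Proof.
under eq_bigr do rewrite exprn_mabs.
rewrite (sum_box_prod N (fun _ i => 2^-1 ^+ i)).
rewrite prodr_const card_ord lerXn2r ?nnegrE ?sum_half_pow//.
by apply: sumr_ge0 => i _; rewrite exprn_ge0// invr_ge0.
Qed.

Lemma sub_box d (s : seq (mindex d)) : exists N, {subset s <= box d N}.
Proof.
exists (\max_(n <- s) mabs n).+1 => n ns; rewrite mem_box; apply/forallP => j.
rewrite ltnS (@leq_trans (mabs n))//; first by rewrite /mabs (bigD1 j)//= leq_addr.
by rewrite (big_rem _ ns)/= leq_maxl.
Qed.

Lemma le_sum_uniq (I : eqType) (s t : seq I) (F : I -> R) :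
  uniq s -> uniq t -> {subset s <= t} -> (forall i, 0 <= F i) ->
  \sum_(i <- s) F i <= \sum_(i <- t) F i.
Proof.
move=> us ut st F0; have pm : perm_eq [seq i <- t | i \in s] s.
  apply: uniq_perm => //; first exact: filter_uniq.
  by move=> i; rewrite mem_filter; apply: andb_idr; exact: st.
have -> : \sum_(i <- s) F i = \sum_(i <- t | i \in s) F i.
  by rewrite -[RHS]big_filter (perm_big _ pm).
by rewrite [leRHS](bigID [in s])/= lerDl sumr_ge0.
Qed.

Lemma sum_uniq_geo d (s : seq (mindex d)) : uniq s ->
  \sum_(n <- s) 2^-1 ^+ mabs n <= 2 ^+ d :> R.
Proof.
move=> us; have [N sN] := sub_box s; apply: le_trans (sum_box_geo d N).
have F0 (i : mindex d) : 0 <= 2^-1 ^+ mabs i :> R by rewrite exprn_ge0// invr_ge0.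
exact: le_sum_uniq (box_uniq _ _) sN F0.
Qed.

(** Half of the decay, one factor 2^-|n|, is at most 2^-N on these indices; the other sums to at
    most 2^d. This is why the ratio 1/4 recurs. *)
Lemma sum_modc_uniq_out d N M (u : mindex d -> R[i]) (s : seq (mindex d)) :
  (forall n, modc (u n) <= M * 4^-1 ^+ mabs n) -> uniq s ->
  {in s, forall n, N <= mabs n}%N ->
  \sum_(n <- s) modc (u n) <= M * 2 ^+ d * 2^-1 ^+ N.
Proof.
move=> hu us sN.
have M0 : 0 <= M.
  have := le_trans (modc_ge0 _) (hu [ffun=> 0%N]).
  by rewrite pmulr_lge0// exprn_gt0// invr_gt0.
apply: (@le_trans _ _ (\sum_(n <- s) M * 2^-1 ^+ N * 2^-1 ^+ mabs n)).
  rewrite big_seq [leRHS]big_seq; apply: ler_sum => n ns.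
  rewrite (le_trans (hu n))// -mulrA ler_wpM2l//.
  have -> : 4^-1 = 2^-1 * 2^-1 :> R by field.
  rewrite exprMn ler_wpM2r ?exprn_ge0 ?invr_ge0//.
  by rewrite ler_wiXn2l ?sN// ?invr_ge0// invf_le1// ler1n.
rewrite -mulr_sumr [leRHS]mulrAC ler_wpM2l ?sum_uniq_geo// mulr_ge0//.
Qed.

Lemma sum_uniq_geo_out d N M (u : mindex d -> R[i]) (s : seq (mindex d)) :
  (forall n, modc (u n) <= M * 4^-1 ^+ mabs n) -> uniq s ->
  {in s, forall n, N <= mabs n}%N ->
  modc (\sum_(n <- s) u n) <= M * 2 ^+ d * 2^-1 ^+ N.
Proof.
move=> hu us sN; rewrite (le_trans (modc_sum _ _ _))//.
exact: sum_modc_uniq_out.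
Qed.

Lemma box_sum_split d N K (u : mindex d -> R[i]) : (N <= K)%N ->
  box_sum u K - box_sum u N = \sum_(n <- box d K | n \notin box d N) u n.
Proof.
move=> NK; have pm : perm_eq [seq n <- box d K | n \in box d N] (box d N).
  apply: uniq_perm; [exact/filter_uniq/box_uniq|exact: box_uniq|].
  move=> n; rewrite mem_filter; apply: andb_idr; rewrite !mem_box => /forallP h.
  by apply/forallP => j; rewrite (leq_trans (h j)).
rewrite !box_sumE.
have -> : \sum_(n <- box d N) u n = \sum_(n <- box d K | n \in box d N) u n.
  by rewrite -[RHS]big_filter (perm_big _ pm).
by rewrite [X in X - _ = _](bigID [in box d N])/= addrAC subrr add0r.
Qed.

Lemma box_sum_cvg d M (u : mindex d -> R[i]) :
  (forall n, modc (u n) <= M * 4^-1 ^+ mabs n) ->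
  exists2 z, box_sum u @ \oo --> z &
    forall N, modc (z - box_sum u N) <= 2 * (M * 2 ^+ d) * 2^-1 ^+ N.
Proof.
move=> hu; apply: geo_cvg => N; rewrite box_sum_split// -big_filter.
apply: sum_uniq_geo_out => //; first exact/filter_uniq/box_uniq.
by move=> n; rewrite mem_filter => /andP[/notin_box].
Qed.

Lemma modc_box_sum_le d M (u : mindex d -> R[i]) N :
  (forall n, modc (u n) <= M * 4^-1 ^+ mabs n) ->
  modc (box_sum u N) <= M * 2 ^+ d.
Proof.
move=> hu; rewrite box_sumE -[leRHS]mulr1 -(expr0 2^-1).
by apply: sum_uniq_geo_out => //; exact: box_uniq.
Qed.

Lemma geo_msummable d M (u : mindex d -> R[i]) :
  (forall n, modc (u n) <= M * 4^-1 ^+ mabs n) -> msummable u.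
Proof.
move=> hu; rewrite /msummable /summable.
apply: (@le_lt_trans _ _ (M * 2 ^+ d)%:E); last by rewrite ltry.
apply: ub_ereal_sup => _ [X [finX _] <-].
rewrite fsbig_finite//.
rewrite (eq_bigr (fun n => (modc (u n))%:E)); last first.
  by move=> n _; rewrite gee0_abs// lee_fin; exact: modc_ge0.
(* Taking [N = 0] imposes nothing on the indices, so every finite subsum is bounded. *)
rewrite sumEFin lee_fin -[leRHS]mulr1 -(expr0 2^-1).
by apply: sum_modc_uniq_out => //; exact: fset_uniq.
Qed.

Lemma msumE d (u : mindex d -> R[i]) z : box_sum u @ \oo --> z -> Defs.msum u = z.
Proof. by move=> h; apply/cvg_lim => //; exact: norm_hausdorff. Qed.

End Boxes.

(** * Recovering the Hermite coefficients *)

Section HermiteCoefficients.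
Variable R : realType.
Implicit Types (d N : nat) (M t : R).
Local Notation mu := (@lebesgue_measure R).

(** Since 12 = 2 * 6, the partial sums are bounded by 2M uniformly in t, so 2M |h_n| dominates the
    integrands. *)
Lemma Rintegral_hermite_series (al : nat -> R) M n (g : R -> R) :
  (forall i, `|al i| <= M * 12^-1 ^+ i) ->
  (forall t, (fun N => \sum_(i < N) al i * hermite_fun i t) @ \oo --> g t) ->
  \int[mu]_t (g t * hermite_fun n t) = al n.
Proof.
move=> hal hg; pose S N t := \sum_(i < N) al i * hermite_fun i t.
have M0 : 0 <= M by have := le_trans (normr_ge0 _) (hal 0); rewrite expr0 mulr1.
have h12 : 12^-1 * 6 = 2^-1 :> R by field.
have S_le N t : `|S N t| <= 2 * M.
  rewrite (le_trans (ler_norm_sum _ _ _))// [leRHS]mulrC.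
  apply: le_trans (ler_wpM2l M0 (sum_half_pow R N)); rewrite mulr_sumr.
  apply: ler_sum => i _; rewrite normrM.
  apply: le_trans (ler_pM (normr_ge0 _) (normr_ge0 _) (hal i) (hermite_fun_le i t)) _.
  by rewrite -mulrA -exprMn h12.
have mS N : measurable_fun setT (fun t => S N t * hermite_fun n t).
  apply: measurable_funM; last exact: measurable_hermite_fun.
  apply: measurable_sum => i; apply: measurable_funM => //.
  exact: measurable_hermite_fun.
have cS t : (fun N => S N t * hermite_fun n t) @ \oo --> g t * hermite_fun n t.
  by apply: cvgMr_tmp; exact: hg.
have [_ _] : [/\ mu.-integrable setT (EFin \o (fun t => g t * hermite_fun n t)),
    ([sequence \int[mu]_t `|(S N t * hermite_fun n t)%:E - (g t * hermite_fun n t)%:E|]_N @ \oo --> 0)%E &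
    ([sequence \int[mu]_t (S N t * hermite_fun n t)%:E]_N @ \oo --> \int[mu]_t (g t * hermite_fun n t)%:E)%E].
  apply: (@dominated_convergence _ _ _ mu setT measurableT
    (fun N t => (S N t * hermite_fun n t)%:E) _
    (fun t => (2 * M)%:E * `|(EFin \o @hermite_fun R n) t|)%E).
  - by move=> N; apply/measurable_EFinP; exact: mS.
  - apply/measurable_EFinP.
    by apply: (measurable_fun_cvg (h := fun N t => S N t * hermite_fun n t)).
  - by apply: aeW => t _; apply: cvg_EFin; [near=> N|exact: cS].
  - apply: integrableZl => //; apply: integrable_abse.
    exact: integrable_hermite_fun.
  - apply: aeW => t N _; rewrite /= lee_fin normrM ler_wpM2r//.
have iS N : mu.-integrable setT (EFin \o (fun t => S N t * hermite_fun n t)) /\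
    \int[mu]_t (S N t * hermite_fun n t) = \sum_(i < N) al i * (nat_of_ord i == n)%:R.
  elim: N => [|N [IH1 IH2]].
    have -> : (fun t => S 0 t * hermite_fun n t) = cst 0.
      by apply/funext => t; rewrite /S big_ord0 mul0r.
    rewrite big_ord0; split; first exact: integrable0.
    by rewrite /Rintegral integral0.
  have -> : (fun t => S N.+1 t * hermite_fun n t) =
      (fun t => S N t * hermite_fun n t + al N * (hermite_fun N t * hermite_fun n t)).
    by apply/funext => t; rewrite /S big_ord_recr /= mulrDl mulrA.
  have iN : mu.-integrable setT (EFin \o (fun t => al N * (hermite_fun N t * hermite_fun n t))).
    by have := integrableZl measurableT (al N) (integrable_hermite_funM _ N n).
  split; first by have := integrableD measurableT IH1 iN; apply: eq_integrable.
  rewrite RintegralD// IH2 big_ord_recr /=; congr (_ + _).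
  by rewrite RintegralZl ?hermite_fun_orthonormal//; exact: integrable_hermite_funM.
move=> h.
suff h0 : (\int[mu]_t (S N t * hermite_fun n t)%:E)%E @[N --> \oo] --> (al n)%:E.
  by rewrite /Rintegral (cvg_unique _ h h0).
(* Once [N > n], orthonormality makes the integral of the partial sum exactly [al n]. *)
apply: cvg_near_cst; exists n.+1 => // N /= nN.
have [iN eN] := iS N; rewrite -[LHS]fineK; last exact: integrable_fin_num.
rewrite -[fine _]/(\int[mu]_t (S N t * hermite_fun n t)) eN; congr EFin.
rewrite (bigD1 (Ordinal nN))//= eqxx mulr1 big1 ?addr0// => i /eqP ni.
by case: eqP => [e|]; rewrite ?mulr0//; case: ni; apply: val_inj.
Unshelve. all: end_near. Qed.

Lemma cintegral_hermite_series (al : nat -> R[i]) M n (g : R -> R[i]) :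
  (forall i, modc (al i) <= M * 12^-1 ^+ i) ->
  (forall t, (fun N => \sum_(i < N) al i * (hermite_fun i t)%:C) @ \oo --> g t) ->
  cintegral (fun t => g t * (hermite_fun n t)%:C) = al n.
Proof.
move=> hal hg; rewrite /cintegral.
have ReM (z : R[i]) (x : R) : complex.Re (z * x%:C) = complex.Re z * x.
  by case: z => a b /=; rewrite mulr0 subr0.
have ImM (z : R[i]) (x : R) : complex.Im (z * x%:C) = complex.Im z * x.
  by case: z => a b /=; rewrite mulr0 add0r.
rewrite [RHS](_ : _ = Complex (complex.Re (al n)) (complex.Im (al n))); last by case: (al n).
congr Complex.
- transitivity (\int[mu]_t ((@complex.Re R \o g) t * hermite_fun n t)).
    by apply: eq_Rintegral => t _; rewrite ReM.
  rewrite (@Rintegral_hermite_series (@complex.Re R \o al) M n (@complex.Re R \o g))// => [i|t].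
    exact: le_trans (Re_le_modc _) (hal i).
  apply/cvgrPdist_lt => e e0; have /cvg_modcP/(_ _ e0) := hg t.
  apply: filterS => N; apply: le_lt_trans.
  apply: le_trans (Re_le_modc _); rewrite raddfB le_eqVlt; apply/orP; left.
  apply/eqP; congr (`|_ - _|); rewrite raddf_sum; apply: eq_bigr => i _.
  exact/esym/ReM.
- transitivity (\int[mu]_t ((@complex.Im R \o g) t * hermite_fun n t)).
    by apply: eq_Rintegral => t _; rewrite ImM.
  rewrite (@Rintegral_hermite_series (@complex.Im R \o al) M n (@complex.Im R \o g))// => [i|t].
    exact: le_trans (Im_le_modc _) (hal i).
  apply/cvgrPdist_lt => e e0; have /cvg_modcP/(_ _ e0) := hg t.
  apply: filterS => N; apply: le_lt_trans.
  apply: le_trans (Im_le_modc _); rewrite raddfB le_eqVlt; apply/orP; left.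
  apply/eqP; congr (`|_ - _|); rewrite raddf_sum; apply: eq_bigr => i _.
  exact/esym/ImM.
Qed.

Definition mcons d (i : nat) (m : mindex d) : mindex d.+1 :=
  [ffun j => if unlift ord0 j is Some j' then m j' else i].

Lemma mcons0 d i (m : mindex d) : mcons i m ord0 = i.
Proof. by rewrite ffunE unlift_none. Qed.

Lemma mconsS d i (m : mindex d) j : mcons i m (lift ord0 j) = m j.
Proof. by rewrite ffunE liftK. Qed.

Lemma mcons_eta d (n : mindex d.+1) :
  n = mcons (n ord0) [ffun j => n (lift ord0 j)].
Proof. by apply/ffunP => j; rewrite ffunE; case: unliftP => [k|] ->; rewrite ?ffunE. Qed.

Lemma mabs_mcons d i (m : mindex d) : mabs (mcons i m) = (i + mabs m)%N.
Proof.
rewrite /mabs big_ord_recl mcons0; congr addn.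
by apply: eq_bigr => j _; rewrite mconsS.
Qed.

Lemma hermite_d_cons d i (m : mindex d) t (y : 'I_d -> R) :
  hermite_d (mcons i m) (xcons t y) = hermite_fun i t * hermite_d m y.
Proof.
rewrite /hermite_d big_ord_recl mcons0 /xcons unlift_none; congr (_ * _).
by apply: eq_bigr => j _; rewrite mconsS liftK.
Qed.

Lemma sum_boxS (A : nmodType) d N (F : mindex d.+1 -> A) :
  \sum_(n <- box d.+1 N) F n = \sum_(m <- box d N) \sum_(i < N) F (mcons i m).
Proof.
have pm : perm_eq (box d.+1 N) [seq mcons i m | m <- box d N, i <- index_iota 0 N].
  apply: uniq_perm; first exact: box_uniq.
    apply: allpairs_uniq; [exact: box_uniq|exact: iota_uniq|].
    move=> [m i] [m' i'] _ _ /= /ffunP h; have := h ord0; rewrite !mcons0 => ->.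
    by congr pair; apply/ffunP => j; have := h (lift ord0 j); rewrite !mconsS.
  move=> n; rewrite mem_box; apply/forallP/allpairsP => /=.
    move=> h; exists ([ffun j => n (lift ord0 j)], n ord0) => /=; split.
    - by rewrite mem_box; apply/forallP => j; rewrite ffunE.
    - by rewrite mem_index_iota h.
    - exact: mcons_eta.
  move=> [[m i] /= [hm hi ->]] j; rewrite ffunE.
  move: hm; rewrite mem_box => /forallP hm.
  case: unliftP => [k _|_]; first exact: hm.
  by move: hi; rewrite mem_index_iota.
rewrite (perm_big _ pm)/= big_allpairs_dep; apply: eq_bigr => m _.
by rewrite big_mkord.
Qed.

Lemma hermite_d_le d (n : mindex d) (x : 'I_d -> R) :
  `|hermite_d n x| <= 6 ^+ mabs n.
Proof.
rewrite exprn_mabs normr_prod; apply: ler_prod => j _.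
by rewrite normr_ge0 hermite_fun_le.
Qed.

Lemma cvg_modc_near (u v : nat -> R[i]) z M :
  u @ \oo --> (z : R[i]) -> (forall n, modc (u n - v n) <= M * 2^-1 ^+ n) ->
  v @ \oo --> (z : R[i]).
Proof.
move=> /cvg_modcP hu uv; apply/cvg_modcP => e e0.
have e2 : 0 < e / 2 by rewrite divr_gt0.
near=> n; have -> : z - v n = (z - u n) + (u n - v n) by ring.
rewrite (le_lt_trans (modcD _ _))// (splitr e) ltrD//.
  by near: n; exact: hu.
by rewrite (le_lt_trans (uv n))//; near: n; exact: exp2V_cvg0.
Unshelve. all: end_near. Qed.

(** Induction on d. With the first coordinate fixed at t, summing over the first index gives the
    coefficients [B t m] of the slice of f; the induction hypothesis recovers them, and the outer
    integral is one-dimensional. *)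
Lemma hermite_coefE d (a : mindex d -> R[i]) M (f : ('I_d -> R) -> R[i]) n :
  (forall m, modc (a m) <= M * 24^-1 ^+ mabs m) ->
  (forall x, box_sum (fun m => a m * (hermite_d m x)%:C) @ \oo --> f x) ->
  hermite_coef f n = a n.
Proof.
elim: d a M f n => [|d IH] a M f n ha hf.
  have E (m : mindex 0) : m = n by apply/ffunP => -[].
  have := hf (fun=> 0); rewrite /hermite_coef /=.
  rewrite /hermite_d big_ord0 mulr1 => h0.
  apply: cvg_modc_unique h0 _; apply: cvg_near_cst; near=> N.
  rewrite box_sumE (perm_big [:: n]); first by rewrite big_seq1 big_ord0 mulr1.
  apply: uniq_perm => [||m]; rewrite ?box_uniq// inE (E m) eqxx mem_box.
  by apply/forallP => -[].
have M0 : 0 <= M by have := le_trans (modc_ge0 _) (ha [ffun=> 0%N]); rewrite pmulr_lge0// exprn_gt0// invr_gt0.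
pose P t m N := \sum_(i < N) a (mcons i m) * (hermite_fun i t)%:C.
have hP t m N : modc (P t m N.+1 - P t m N) <= M * 24^-1 ^+ mabs m * 2^-1 ^+ N.
  rewrite /P big_ord_recr /= addrAC subrr add0r modcM modcR.
  apply: le_trans (ler_pM (modc_ge0 _) (normr_ge0 _) (ha _) (hermite_fun_le N t)) _.
  rewrite mabs_mcons addnC exprD -!mulrA ler_wpM2l// ler_wpM2l ?exprn_ge0 ?invr_ge0//.
  by rewrite -exprMn lerXn2r ?nnegrE//; lra.
pose B t m := lim (P t m @ \oo).
have hB t m : P t m @ \oo --> B t m /\
    forall N, modc (B t m - P t m N) <= 2 * (M * 24^-1 ^+ mabs m) * 2^-1 ^+ N.
  have [z hz zN] := geo_cvg (hP t m); suff -> : B t m = z by [].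
  by apply/cvg_lim => //; exact: norm_hausdorff.
rewrite /hermite_coef /= (_ : (fun t => _) =
    fun t => B t [ffun j => n (lift ord0 j)] * (hermite_fun (n ord0) t)%:C).
  rewrite [RHS](congr1 a (mcons_eta n)).
  apply: (@cintegral_hermite_series (fun i => a (mcons i _)) M) => [i|t]; last first.
    by have [] := hB t [ffun j => n (lift ord0 j)].
  rewrite (le_trans (ha _))// ler_wpM2l// mabs_mcons exprD.
  rewrite -[leRHS]mulr1 ler_pM ?exprn_ge0 ?invr_ge0//.
    by rewrite lerXn2r ?nnegrE//; lra.
  by rewrite exprn_ile1//; lra.
apply/funext => t.
(* The factor h_(n_0)(t) does not depend on y, so it can be absorbed into the coefficients of the
   slice. *)
pose f' y := f (xcons t y) * (hermite_fun (n ord0) t)%:C.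
transitivity (hermite_coef f' [ffun j => n (lift ord0 j)]).
  rewrite /hermite_coef; congr integral_Rd; apply/funext => y.
  by rewrite [n in LHS]mcons_eta hermite_d_cons rmorphM mulrA.
apply: (IH (fun m => B t m * (hermite_fun (n ord0) t)%:C) (2 * M * 6 ^+ n ord0)) => [m|y].
  have [_ /(_ 0)] := hB t m; rewrite /P big_ord0 subr0 expr0 mulr1 => hBm.
  rewrite modcM modcR.
  apply: le_trans (ler_pM (modc_ge0 _) (normr_ge0 _) hBm (hermite_fun_le _ t)) _.
  by rewrite le_eqVlt; apply/orP; left; apply/eqP; ring.
have -> : box_sum (fun m => B t m * (hermite_fun (n ord0) t)%:C * (hermite_d m y)%:C)
  = (fun N => box_sum (fun m => B t m * (hermite_d m y)%:C) N * (hermite_fun (n ord0) t)%:C).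
  apply/funext => N; rewrite !box_sumE mulr_suml; apply: eq_bigr => m _.
  by rewrite mulrAC.
apply: cvgMr_tmp.
(* The box in dimension d + 1 also truncates the inner sum, with [P t m N] in place of [B t m]; the
   total error is O(2^-N), using 6 / 24 = 1 / 4. *)
apply: (@cvg_modc_near _ _ _ (2 * M * 2 ^+ d)) (hf (xcons t y)) _ => N.
rewrite !box_sumE sum_boxS -sumrB.
have -> : 2 * M * 2 ^+ d * 2^-1 ^+ N = (2 * M * 2^-1 ^+ N) * 2 ^+ d * 2^-1 ^+ 0.
  by rewrite expr0; ring.
apply: sum_uniq_geo_out => // [m|]; last exact: box_uniq.
have -> : \sum_(i < N) a (mcons i m) * (hermite_d (mcons i m) (xcons t y))%:C -
   B t m * (hermite_d m y)%:C = - ((B t m - P t m N) * (hermite_d m y)%:C).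
  rewrite mulrBl opprB /P mulr_suml; congr (_ - _); apply: eq_bigr => i _.
  by rewrite hermite_d_cons rmorphM mulrA.
rewrite modcN modcM modcR.
have [_ /(_ N) hBm] := hB t m.
apply: le_trans (ler_pM (modc_ge0 _) (normr_ge0 _) hBm (hermite_d_le m y)) _.
have -> : 4^-1 = 24^-1 * 6 :> R by field.
by rewrite exprMn le_eqVlt; apply/orP; left; apply/eqP; ring.
Unshelve. all: end_near. Qed.

End HermiteCoefficients.

(** * Decay of the coefficients *)

Section Decay.
Variable R : realType.
Implicit Types (d N : nat) (M p A : R).

Lemma mfact_gt0 d (n : mindex d) : (0 < mfact n)%N.
Proof. by rewrite prodn_gt0// => j; rewrite fact_gt0. Qed.

(** With B = A^(1/p), the bound B^k <= k! e^B in each coordinate is multiplied over the coordinates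
    and raised to the power p. *)
Lemma geo_le_mfact d p A : 0 < p -> 0 < A ->
  exists2 K, 0 < K & forall n : mindex d, A ^+ mabs n <= K * (mfact n)%:R `^ p.
Proof.
move=> p0 A0; pose B := A `^ p^-1; have B0 : 0 < B by rewrite powR_gt0.
have BpA : B `^ p = A by rewrite -powRrM mulVf ?gt_eqF// powRr1// ltW.
exists ((expR B ^+ d) `^ p) => [|n]; first by rewrite powR_gt0// exprn_gt0// expR_gt0.
rewrite -powRM ?exprn_ge0 ?expR_ge0//.
have -> : A ^+ mabs n = (B ^+ mabs n) `^ p.
  by rewrite -[in RHS]powR_mulrn ?(ltW B0)// powRAC BpA powR_mulrn// ltW.
rewrite ge0_ler_powR ?nnegrE ?exprn_ge0 ?mulr_ge0 ?exprn_ge0 ?expR_ge0 ?(ltW p0) ?(ltW B0)//.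
rewrite exprn_mabs /mfact natr_prod mulrC -[X in _ ^+ X]card_ord -prodr_const -big_split /=.
apply: ler_prod => j _; rewrite exprn_ge0 ?(ltW B0)//=.
by rewrite exprn_le_expR// ltW.
Qed.

Lemma leq_fact_add m n : (m`! * n`! <= (m + n)`!)%N.
Proof.
elim: m => [|m IH]; first by rewrite mul1n.
by rewrite addSn !factS -mulnA leq_mul// ltnS leq_addr.
Qed.

Lemma leq_mfact_madd d (k n : mindex d) : (mfact k * mfact n <= mfact (madd k n))%N.
Proof.
rewrite /mfact -big_split /=; apply: leq_prod => j _.
by rewrite ffunE leq_fact_add.
Qed.

Lemma leq_mfact_mdouble d (n : mindex d) : (mfact n ^ 2 <= mfact (mdouble n))%N.
Proof.
rewrite -mulnn /mfact -big_split /=; apply: leq_prod => j _.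
by rewrite ffunE -addnn leq_fact_add.
Qed.

Lemma mabs_madd d (k n : mindex d) : mabs (madd k n) = (mabs k + mabs n)%N.
Proof. by rewrite /mabs -big_split; apply: eq_bigr => j _; rewrite ffunE. Qed.

Lemma mabs_mdouble d (n : mindex d) : mabs (mdouble n) = (mabs n * 2)%N.
Proof. by rewrite /mabs big_distrl; apply: eq_bigr => j _; rewrite ffunE -muln2. Qed.

(** Any positive power of n! absorbs the geometric factor (h r)^-|n|; all later ratios are obtained
    here. *)
Lemma lflat_geo d sigma (a : mindex d -> R[i]) (r : R) :
  0 < sigma -> 0 < r -> lflat sigma a ->
  exists M, forall n, modc (a n) <= M * r ^+ mabs n.
Proof.
move=> s0 r0 [h [h0 [M hM]]].
have p0 : 0 < (2 * sigma)^-1 by rewrite invr_gt0 mulr_gt0.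
have A0 : 0 < (h * r)^-1 by rewrite invr_gt0 mulr_gt0.
have [K K0 hK] := @geo_le_mfact d _ _ p0 A0.
exists (M * K) => n; have := hM n; rewrite -/(modc _) => hn.
have F0 : 0 < (mfact n)%:R `^ (2 * sigma)^-1 :> R by rewrite powR_gt0// ltr0n mfact_gt0.
have M0 : 0 <= M by apply: le_trans hn; rewrite !mulr_ge0 ?modc_ge0 ?exprn_ge0 ?ltW.
have := hK n; rewrite exprVn exprMn invfM.
move: (h ^+ mabs n) (r ^+ mabs n) (exprn_gt0 (mabs n) h0) (exprn_gt0 (mabs n) r0) hn F0.
move: (_ `^ _) (modc (a n)) (modc_ge0 (a n)) => F u u0 H r' H0 r'0 hn F0 hF.
rewrite -(ler_pM2r (mulr_gt0 H0 F0)) mulrA (le_trans hn)//.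
have h1 : 1 <= K * r' * (H * F).
  have := ler_wpM2r (ltW (mulr_gt0 H0 r'0)) hF.
  rewrite (_ : H^-1 / r' * (H * r') = 1); last by field; rewrite !gt_eqF.
  by rewrite (_ : K * F * (H * r') = K * r' * (H * F)); last by ring.
rewrite (_ : M * K * r' * (H * F) = M * (K * r' * (H * F))); last by ring.
by rewrite ler_peMr.
Qed.

(** Halving sigma doubles the exponent of n!, and n! >= 1. *)
Lemma lflat_half d sigma (a : mindex d -> R[i]) : 0 < sigma ->
  lflat (sigma / 2) a -> lflat sigma a.
Proof.
move=> s0 [h [h0 [M hM]]]; exists h; split=> //; exists M => n.
apply: le_trans (hM n); rewrite ler_wpM2l//.
  by rewrite mulr_ge0 ?exprn_ge0 ?(ltW h0)// modc_ge0.
rewrite ler_powR ?ler1n ?mfact_gt0// mulrCA divff ?mulr1//.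
by rewrite lef_pV2 ?posrE ?mulr_gt0//; lra.
Qed.

(* The factor [8] leaves [4 ^- mabs k] after absorbing the [2 ^+ mabs k] of the
   weights. *)
Lemma lflat_shift d sigma (a : mindex d -> R[i]) : 0 < sigma -> lflat sigma a ->
  exists h, 0 < h /\ exists M, forall n k : mindex d,
    modc (a (mdouble (madd k n))) * 8 ^+ mabs k * h ^+ mabs n
      * (mfact n)%:R `^ sigma^-1 <= M.
Proof.
move=> s0 [h [h0 [M hM]]].
have p0 : 0 < sigma^-1 by rewrite invr_gt0.
have h20 : 0 < h ^+ 2 by rewrite exprn_gt0.
have A0 : 0 < 8 / h ^+ 2 by rewrite divr_gt0.
have [K K0 hK] := @geo_le_mfact d _ _ p0 A0.
exists (h ^+ 2); split=> //; exists (M * K) => n k.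
have := hM (mdouble (madd k n)); rewrite -/(modc _) => hn.
have F0 (m : mindex d) : 0 < (mfact m)%:R `^ sigma^-1 :> R by rewrite powR_gt0// ltr0n mfact_gt0.
(* From (2(k+n))! >= ((k+n)!)^2 >= (k! n!)^2. The power of k! pays for (8 / h^2)^|k|; the power of
   n! is the weight in the conclusion. *)
have hF : (mfact k)%:R `^ sigma^-1 * (mfact n)%:R `^ sigma^-1
    <= (mfact (mdouble (madd k n)))%:R `^ (2 * sigma)^-1 :> R.
  have -> : sigma^-1 = 2 * (2 * sigma)^-1 by field; rewrite gt_eqF.
  rewrite -powRM// powRrM ge0_ler_powR ?nnegrE ?powR_ge0 ?invr_ge0 ?mulr_ge0 ?(ltW s0)//.
  rewrite powR_mulrn ?mulr_ge0// -natrM -natrX ler_nat.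
  by rewrite (leq_trans _ (leq_mfact_mdouble _))// leq_exp2r// leq_mfact_madd.
have hk := hK k; rewrite expr_div_n ler_pdivrMr ?exprn_gt0// in hk.
have u0 := modc_ge0 (a (mdouble (madd k n))).
have M0 : 0 <= M by apply: le_trans hn; rewrite !mulr_ge0 ?exprn_ge0 ?powR_ge0 ?(ltW h0).
rewrite mabs_mdouble mulnC exprM mabs_madd exprD in hn.
move: (modc _) (h ^+ 2 ^+ mabs k) (h ^+ 2 ^+ mabs n) (exprn_gt0 (mabs k) h20)
  (exprn_gt0 (mabs n) h20) hn hk u0 hF => u Hk Hn Hk0 Hn0 hn hk u0.
move: (F0 k) (F0 n) hk hn (powR_ge0 (mfact (mdouble (madd k n)))%:R (2 * sigma)^-1).
move: (_ `^ (2 * sigma)^-1) (_ `^ sigma^-1) (_ `^ sigma^-1) => G Fn Fk Fk0 Fn0 hk hn G0 hF.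
apply: (@le_trans _ _ (u * (K * Fk * Hk) * Hn * Fn)).
  by rewrite !ler_wpM2r ?(ltW Fn0) ?(ltW Hn0)// ler_wpM2l.
rewrite (_ : u * _ * _ * _ = K * (u * (Hk * Hn) * (Fk * Fn))); last by ring.
rewrite mulrC ler_wpM2r ?(ltW K0)//; apply: le_trans hn.
by rewrite ler_wpM2l// !mulr_ge0// ltW.
Qed.

End Decay.

(** * Hermite functions of even index at a square root *)

Section HermiteLaguerre.
Variable R : realType.
Implicit Types (d N m n : nat) (t : R).

Lemma half_binom_le1 k : `|half_binom R k| <= 1.
Proof.
elim: k => [|k IH]; first by rewrite half_binom0 normr1.
rewrite half_binomS -mulrA normrM -[leRHS]mulr1 ler_pM// normrM.
rewrite normfV normr_nat ler_pdivrMr ?ltr0n// mul1r ler_norml -natr1.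
by have := ler0n R k => k0; apply/andP; split; lra.
Qed.

(** Each t^i / i! is at most e^t and the binomial coefficients sum to 2^m. *)
Lemma laguerre_fun_le m t : 0 < t -> `|laguerre_fun m t| <= 2 ^+ m * expR (t / 2).
Proof.
move=> t0; rewrite /laguerre_fun laguerre_polyE normrM (ger0_norm (expR_ge0 _)).
have -> : expR (t / 2) = expR t * expR (- t / 2).
  by rewrite -expRD; congr expR; field.
rewrite mulrA ler_wpM2r ?expR_ge0// horner_poly.
rewrite (le_trans (ler_norm_sum _ _ _))//.
have -> : 2 ^+ m = \sum_(i < m.+1) 'C(m, i)%:R :> R.
  rewrite (_ : 2 = 1 + 1 :> R)// exprDn; apply: eq_bigr => i _.
  by rewrite !expr1n mulr1.
rewrite mulr_suml; apply: ler_sum => i _.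
rewrite !normrM normfV !normr_nat normrX normrN1 expr1n mulr1 -mulrA ler_wpM2l//.
rewrite normrX (gtr0_norm t0) mulrC ler_pdivrMr ?ltr0n ?fact_gt0// mulrC.
by rewrite exprn_le_expR// ltW.
Qed.

(** At x = sqrt t the factor exp(-x^2 / 2) becomes the exp(-t / 2) of the Laguerre functions, and
    4^m over the normalization sqrt(2^(2m)) leaves 2^m. *)
Lemma hermite_fun_sqrt m t : 0 < t ->
  hermite_fun m.*2 (Num.sqrt t) = (Num.sqrt (Num.sqrt pi))^-1 *
    ((-1) ^+ m * 2 ^+ m * m`!%:R / Num.sqrt m.*2`!%:R) *
    \sum_(k < m.+1) half_binom R k * laguerre_fun (m - k) t.
Proof.
move=> t0; rewrite hermite_funE sqr_sqrtr ?(ltW t0)//.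
rewrite hermiteP_laguerreP hornerZ horner_comp hornerXn sqr_sqrtr ?(ltW t0)//.
have -> : \sum_(k < m.+1) half_binom R k * laguerre_fun (m - k) t =
    (\sum_(k < m.+1) half_binom R k *: laguerreP R (m - k)).[t] * expR (- t / 2).
  rewrite horner_sum mulr_suml; apply: eq_bigr => k _.
  by rewrite hornerZ /laguerre_fun laguerre_polyE mulrA.
rewrite /hermite_sqnorm -muln2 exprM -mulrA sqrtrM ?sqr_ge0// sqrtr_sqr.
rewrite ger0_norm ?exprn_ge0// sqrtrM//.
have h1 : Num.sqrt (Num.sqrt pi) != 0 :> R by rewrite gt_eqF// !sqrtr_gt0 pi_gt0.
have h2 : Num.sqrt (m * 2)`!%:R != 0 :> R.
  by rewrite gt_eqF// sqrtr_gt0 ltr0n fact_gt0.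
have h3 : 2 ^+ m != 0 :> R by rewrite expf_neq0.
rewrite (_ : 4 = 2 * 2 :> R); last by ring.
rewrite exprMn; field.
by rewrite h1 h2 h3.
Qed.

(** With the indicator, the summation ranges no longer depend on m, so a product over coordinates
    can be distributed. *)
Lemma sum_convolution (A : comNzRingType) m N (F G : nat -> A) : (m < N)%N ->
  \sum_(k < m.+1) F k * G (m - k)%N =
  \sum_(n < N) \sum_(k < N) (k + n == m)%N%:R * (F k * G n).
Proof.
move=> mN; rewrite exchange_big /=.
rewrite (big_ord_widen N (fun k => F k * G (m - k)%N))// [LHS]big_mkcond.
apply: eq_bigr => k _; case: ifPn => [km|].
  have kmN : (m - k < N)%N by rewrite (leq_ltn_trans _ mN)// leq_subr.
  rewrite (bigD1 (Ordinal kmN))//= subnKC ?eqxx// mul1r big1 ?addr0// => n /eqP nk.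
  case: eqP => [e|]; last by rewrite mul0r.
  by case: nk; apply: val_inj => /=; rewrite -e addKn.
rewrite -leqNgt => mk; apply/esym/big1 => n _; case: eqP => [e|]; last by rewrite mul0r.
by move: mk; rewrite -e ltnNge leq_addr.
Qed.

Lemma hermite_fun_opp m t : hermite_fun m (- t) = (-1) ^+ m * hermite_fun m t.
Proof.
rewrite !hermite_funE sqrrN.
suff -> : (hermiteP m).[- t] = (-1) ^+ m * (hermiteP m).[t] by ring.
suff [] : (hermiteP m).[- t] = (-1) ^+ m * (hermiteP m).[t] /\
   (hermiteP m.+1).[- t] = (-1) ^+ m.+1 * (hermiteP m.+1).[t] by [].
elim: m => [|m [IH1 IH2]].
  by rewrite /= -polyC1 derivC subr0 mulr1 !hornerC !hornerMn !hornerX expr0 expr1; split; ring.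
split=> //; rewrite hermitePSS !hornerD !hornerN !hornerM !hornerMn !hornerX IH1 IH2 !exprS.
by rewrite -[_ *+ _.*2]mulr_natr -[(hermiteP m).[t] *+ _]mulr_natr; ring.
Qed.

Definition flip d (j : 'I_d) (x : 'I_d -> R) : 'I_d -> R :=
  fun i => if i == j then - x i else x i.

Lemma hermite_d_flip d j (n : mindex d) (x : 'I_d -> R) :
  hermite_d n (flip j x) = (-1) ^+ n j * hermite_d n x.
Proof.
rewrite /hermite_d (bigD1 j)//= [in RHS](bigD1 j)//= /flip eqxx hermite_fun_opp -mulrA.
by congr (_ * (_ * _)); apply: eq_bigr => i /negbTE ->.
Qed.

Definition weight d (m : mindex d) : R :=
  (-1) ^+ mabs m * 2 ^+ mabs m * (mfact m)%:R / Num.sqrt (mfact (mdouble m))%:R.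

Lemma sqrt_prodr (I : Type) (s : seq I) (F : I -> R) : (forall i, 0 <= F i) ->
  Num.sqrt (\prod_(i <- s) F i) = \prod_(i <- s) Num.sqrt (F i).
Proof.
move=> F0; elim: s => [|i s IH]; first by rewrite !big_nil sqrtr1.
by rewrite !big_cons sqrtrM// IH.
Qed.

Lemma maddE d (k n : mindex d) j : madd k n j = (k j + n j)%N.
Proof. by rewrite ffunE. Qed.

(** Exact although truncated: if m lies in the box, so do all k and n with k + n = m. *)
Lemma hermite_d_sqrt d N (m : mindex d) (x : 'I_d -> R) :
  (forall j, 0 < x j) -> m \in box d N ->
  hermite_d (mdouble m) (wmap x) = (pi `^ (d%:R / 4))^-1 * weight m *
   \sum_(n <- box d N) laguerre_d n x *
     \sum_(k <- box d N | madd k n == m) mbinom_k32 R k.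
Proof.
move=> x0; rewrite mem_box => /forallP mN.
have -> : \sum_(n <- box d N) laguerre_d n x *
     \sum_(k <- box d N | madd k n == m) mbinom_k32 R k =
   \sum_(n <- box d N) \prod_(j < d) \sum_(k < N) (k + n j == m j)%N%:R *
     (half_binom R k * laguerre_fun (n j) (x j)).
  apply: eq_bigr => n _.
  rewrite -(sum_box_prod N (fun j k => (k + n j == m j)%N%:R * (half_binom R k * laguerre_fun (n j) (x j)))).
  rewrite big_mkcond mulr_sumr; apply: eq_bigr => k _.
  rewrite 2!big_split /= -/(laguerre_d n x).
  rewrite (_ : \prod_(j < d) (k j + n j == m j)%N%:R = (madd k n == m)%:R); last first.
    case: eqP => [/ffunP e|e].
      by apply: big1 => j _; rewrite -maddE e eqxx.
    have [j /eqP hj] : exists j, madd k n j != m j.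
      by apply/existsP; rewrite -negb_forall; apply/negP => /forallP h; apply: e; apply/ffunP => j; exact/eqP.
    by rewrite (bigD1 j)//= -maddE; move/eqP/negbTE: hj => ->; rewrite mul0r.
  case: eqP => _; rewrite ?mul0r ?mulr0// mul1r mulrC; congr (_ * _).
rewrite (sum_box_prod N (fun j i => \sum_(k < N) (k + i == m j)%N%:R *
     (half_binom R k * laguerre_fun i (x j)))).
rewrite /hermite_d.
transitivity (\prod_(j < d) ((Num.sqrt (Num.sqrt pi))^-1 *
    ((-1) ^+ m j * 2 ^+ m j * (m j)`!%:R / Num.sqrt (m j).*2`!%:R) *
    \sum_(n < N) \sum_(k < N) (k + n == m j)%N%:R * (half_binom R k * laguerre_fun n (x j)))).
  apply: eq_bigr => j _; rewrite ffunE /wmap hermite_fun_sqrt//; congr (_ * _).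
  by rewrite (@sum_convolution R _ N _ (fun n => laguerre_fun n (x j))).
rewrite big_split /= big_split /=; congr (_ * _ * _).
  rewrite prodr_const card_ord exprVn; congr (_^-1).
  rewrite -!powR12_sqrt ?powR_ge0 ?pi_ge0// -powR_mulrn ?powR_ge0// -!powRrM.
  by congr (_ `^ _); field.
rewrite /weight !big_split /= !exprn_mabs /mfact natr_prod; congr (_ * _).
rewrite prodfV natr_prod sqrt_prodr//; congr (_^-1).
by apply: eq_bigr => j _; rewrite ffunE.
Qed.

End HermiteLaguerre.

(** * Rearrangement *)

Section Expansion.
Variable R : realType.
Implicit Types (d N : nat) (M : R).

Lemma mdouble_inj d : injective (@mdouble d).
Proof.
move=> m n /ffunP h; apply/ffunP => j; have := h j; rewrite !ffunE.
exact: double_inj.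
Qed.

(** In each coordinate 2m < 2N exactly when m < N, so doubling carries the box of side N onto the
    even indices of the box of side 2N. *)
Lemma box_sum_double d (u : mindex d -> R[i]) N :
  (forall (n : mindex d) j, odd (n j) -> u n = 0) ->
  box_sum u N.*2 = \sum_(m <- box d N) u (mdouble m).
Proof.
move=> hu; rewrite box_sumE (bigID [in map (@mdouble d) (box d N)])/=.
rewrite [X in _ + X]big1_seq ?addr0; last first.
  move=> n /andP[nm nb]; have [[j oj]|he] := pselect (exists j, odd (n j)); first exact: hu oj.
  case/negP: nm; apply/mapP; exists [ffun j => (n j)./2].
    rewrite mem_box; apply/forallP => j; rewrite ffunE ltn_half_double.
    by move: nb; rewrite mem_box => /forallP.
  apply/ffunP => j; rewrite !ffunE even_halfK//.
  by apply/negP => oj; apply: he; exists j.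
rewrite -big_filter -(big_map (@mdouble d) xpredT u); apply: perm_big.
apply: uniq_perm; first exact/filter_uniq/box_uniq.
  by rewrite (map_inj_uniq (@mdouble_inj d)) box_uniq.
move=> n; rewrite mem_filter; apply: andb_idr => /mapP[m]; rewrite mem_box => /forallP mN ->.
by rewrite mem_box; apply/forallP => j; rewrite ffunE ltn_double.
Qed.

Lemma cvg_double (u : nat -> R[i]) (z : R[i]) :
  u @ \oo --> z -> (fun N => u N.*2) @ \oo --> z.
Proof.
move=> /cvg_modcP h; apply/cvg_modcP => e e0; have [N _ hN] := h e e0.
by exists N => // n /= Nn; apply: hN => /=; rewrite (leq_trans Nn)// -addnn leq_addr.
Qed.

Lemma hermite_coef_even d (f : ('I_d -> R) -> R[i]) (a : mindex d -> R[i]) M :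
  (forall m, modc (a m) <= M * 24^-1 ^+ mabs m) ->
  (forall x, box_sum (fun m => a m * (hermite_d m x)%:C) @ \oo --> f x) ->
  even_in_each f -> forall (n : mindex d) j, odd (n j) -> a n = 0.
Proof.
move=> ha hf ef n j oj.
have h1 : hermite_coef f n = a n := hermite_coefE n ha hf.
have h2 : hermite_coef f n = ((-1) ^+ n j)%:C * a n.
  apply: (@hermite_coefE _ _ (fun m => ((-1) ^+ m j)%:C * a m) M) => [m|x].
    by rewrite modcM modcR normrX normrN1 expr1n mul1r.
  have -> : box_sum (fun m => ((-1) ^+ m j)%:C * a m * (hermite_d m x)%:C) =
      box_sum (fun m => a m * (hermite_d m (flip j x))%:C).
    apply/funext => N; rewrite !box_sumE; apply: eq_bigr => m _.
    by rewrite hermite_d_flip rmorphM mulrCA mulrA.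
  by rewrite -(ef j x); exact: hf (flip j x).
have : a n *+ 2 = 0.
  rewrite mulr2n -{1}h1 h2 -signr_odd oj expr1 rmorphN1 mulN1r.
  exact: addNr.
by move=> /eqP; rewrite mulrn_eq0 /= => /eqP.
Qed.

Lemma sum_eq_seq (A : nmodType) (I : eqType) (s : seq I) (i : I) (F : I -> A) : uniq s ->
  \sum_(j <- s | i == j) F j = if i \in s then F i else 0.
Proof.
move=> us; case: ifP => [si|/negP si].
  rewrite -big_filter (eq_filter (a2 := pred1 i)); last by move=> j; rewrite /= eq_sym.
  by rewrite filter_pred1_uniq// big_seq1.
by rewrite big1_seq// => j /andP[/eqP <-].
Qed.

Lemma mbinom_le1 d (k : mindex d) : `|mbinom_k32 R k| <= 1.
Proof.
rewrite /mbinom_k32 normr_prod; apply: prodr_ile1 => j _.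
(* The factors of [mbinom_k32] are [half_binom] by conversion. *)
by rewrite normr_ge0/=; exact: half_binom_le1.
Qed.

Lemma laguerre_d_le d (x : 'I_d -> R) : (forall j, 0 < x j) ->
  exists2 E, 0 <= E & forall n, `|laguerre_d n x| <= E * 2 ^+ mabs n.
Proof.
move=> x0; exists (\prod_(j < d) expR (x j / 2)).
  by apply: prodr_ge0 => j _; rewrite expR_ge0.
move=> n; rewrite exprn_mabs -big_split normr_prod; apply: ler_prod => j _.
by rewrite normr_ge0 /= mulrC laguerre_fun_le.
Qed.

(** In the sums tending to F, the indices m, n and k share one box. Each coefficient of a Laguerre
    function is then off by O(2^-N 8^-|n|), and 8^-|n| absorbs the growth 2^|n| to leave 4^-|n|. *)
Lemma laguerre_rearrangement d (al z : mindex d -> R[i]) M (x : 'I_d -> R) (F : R[i]) :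
  (forall j, 0 < x j) ->
  (forall m, modc (al m) <= M * 64^-1 ^+ mabs m) ->
  (forall n, box_sum (fun k => (mbinom_k32 R k)%:C * al (madd k n)) @ \oo --> z n) ->
  (fun N => \sum_(m <- box d N) al m * (\sum_(n <- box d N) laguerre_d n x *
     \sum_(k <- box d N | madd k n == m) mbinom_k32 R k)%:C) @ \oo --> F ->
  box_sum (fun n => z n * (laguerre_d n x)%:C) @ \oo --> F.
Proof.
move=> x0 hal hz hF; have [E E0 hE] := laguerre_d_le x0.
have M0 : 0 <= M.
  have := le_trans (modc_ge0 _) (hal [ffun=> 0%N]).
  by rewrite pmulr_lge0// exprn_gt0// invr_gt0.
pose v n k := (mbinom_k32 R k)%:C * al (madd k n).
have hv n k : modc (v n k) <= M * 64^-1 ^+ mabs n * 64^-1 ^+ mabs k.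
  rewrite modcM modcR -mulrA -exprD addnC -mabs_madd -[leRHS]mul1r.
  by rewrite ler_pM ?modc_ge0// mbinom_le1.
have h64 : 64^-1 = 8^-1 * 8^-1 :> R by field.
have pow_le (p q : R) n : 0 <= p -> p <= q -> p ^+ n <= q ^+ n.
  by move=> p0 pq; rewrite lerXn2r ?nnegrE// (le_trans p0).
have hv4 n k : modc (v n k) <= M * 8^-1 ^+ mabs n * 4^-1 ^+ mabs k.
  apply: le_trans (hv n k) _; rewrite -!mulrA ler_wpM2l//.
  by rewrite ler_pM ?exprn_ge0 ?invr_ge0// pow_le//; lra.
(* Both [k] and [k + n] must lie in the box. The first condition costs a tail with constant 2, the
   second the sum of [v'] with constant 1, hence the 3 below. *)
pose D n N := z n - \sum_(k <- box d N | madd k n \in box d N) v n k.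
have hD n N : modc (D n N) <= 3 * M * 2 ^+ d * 2^-1 ^+ N * 8^-1 ^+ mabs n.
  have [z' hz' /(_ N) hN] := box_sum_cvg (hv4 n).
  have ez : z n = z' := cvg_modc_unique (hz n) hz'.
  pose v' k := if madd k n \in box d N then 0 else v n k.
  have hv' k : modc (v' k) <= M * 2^-1 ^+ N * 8^-1 ^+ mabs n * 4^-1 ^+ mabs k.
    rewrite /v'; case: ifPn => [_|/notin_box].
      by rewrite modc0 !mulr_ge0 ?exprn_ge0 ?invr_ge0.
    rewrite mabs_madd => Nkn; apply: le_trans (hv n k) _.
    (* One factor 8^-(|k|+|n|) gives 2^-N, since |k + n| >= N; the other leaves 8^-|n| and the
       summable 4^-|k|. *)
    rewrite -!mulrA ler_wpM2l// h64 !exprMn.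
    rewrite (_ : _ * _ = 8^-1 ^+ (mabs k + mabs n) * (8^-1 ^+ mabs n * 8^-1 ^+ mabs k)); last first.
      by rewrite exprD; ring.
    rewrite ler_pM ?exprn_ge0 ?mulr_ge0 ?exprn_ge0 ?invr_ge0//; last first.
      by rewrite ler_wpM2l ?exprn_ge0 ?invr_ge0// pow_le//; lra.
    apply: (@le_trans _ _ (2^-1 ^+ (mabs k + mabs n))); first by rewrite pow_le//; lra.
    by rewrite ler_wiXn2l// ?invr_ge0//; lra.
  have -> : D n N = (z' - box_sum (v n) N) + \sum_(k <- box d N) v' k.
    rewrite /D -ez box_sumE (bigID (fun k => madd k n \in box d N) xpredT (v n))/=.
    have -> : \sum_(k <- box d N) v' k = \sum_(k <- box d N | madd k n \notin box d N) v n k.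
      by rewrite [RHS]big_mkcond; apply: eq_bigr => k _; rewrite /v' if_neg.
    by ring.
  apply: (le_trans (modcD _ _)).
  have h2 : modc (\sum_(k <- box d N) v' k) <= M * 2^-1 ^+ N * 8^-1 ^+ mabs n * 2 ^+ d * 2^-1 ^+ 0.
    by apply: sum_uniq_geo_out => //; exact: box_uniq.
  apply: (le_trans (lerD hN h2)).
  by rewrite expr0 le_eqVlt; apply/orP; left; apply/eqP; ring.
apply: (@cvg_modc_near _ _ _ _ (3 * M * 2 ^+ d * E * 2 ^+ d)) hF _ => N.
have -> : \sum_(m <- box d N) al m * (\sum_(n <- box d N) laguerre_d n x *
     \sum_(k <- box d N | madd k n == m) mbinom_k32 R k)%:C =
   \sum_(n <- box d N) (laguerre_d n x)%:C * \sum_(k <- box d N | madd k n \in box d N) v n k.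
  under eq_bigr do rewrite rmorph_sum mulr_sumr.
  rewrite exchange_big /=; apply: eq_bigr => n _.
  under eq_bigr do rewrite rmorphM mulrCA rmorph_sum mulr_sumr big_mkcond.
  rewrite -mulr_sumr exchange_big /=; congr (_ * _).
  rewrite [RHS]big_mkcond; apply: eq_bigr => k _.
  (* Only m = k + n survives, and only if it lies in the box. *)
  rewrite -big_mkcond (sum_eq_seq (madd k n) (fun m => al m * (mbinom_k32 R k)%:C)) ?box_uniq//.
  by case: ifP => // _; rewrite mulrC.
rewrite box_sumE -sumrB.
have -> : 3 * M * 2 ^+ d * E * 2 ^+ d * 2^-1 ^+ N = (3 * M * 2 ^+ d * 2^-1 ^+ N * E) * 2 ^+ d * 2^-1 ^+ 0.
  by rewrite expr0; ring.
apply: sum_uniq_geo_out => // [n|]; last exact: box_uniq.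
have -> : (laguerre_d n x)%:C * \sum_(k <- box d N | madd k n \in box d N) v n k -
  z n * (laguerre_d n x)%:C = - ((laguerre_d n x)%:C * D n N) by rewrite /D; ring.
rewrite modcN modcM modcR.
apply: le_trans (ler_pM (normr_ge0 _) (modc_ge0 _) (hE n) (hD n N)) _.
rewrite (_ : 4^-1 = 2 * 8^-1 :> R); last by field.
by rewrite exprMn le_eqVlt; apply/orP; left; apply/eqP; ring.
Qed.

Lemma weight_le d (m : mindex d) : `|weight R m| <= 2 ^+ mabs m.
Proof.
have F0 : 0 < Num.sqrt (mfact (mdouble m))%:R :> R.
  by rewrite sqrtr_gt0 ltr0n mfact_gt0.
rewrite /weight -mulrA !normrM normrX normrN1 expr1n mul1r normrX normr_nat.
rewrite ler_piMr ?exprn_ge0// normr_nat normfV (gtr0_norm F0) ler_pdivrMr// mul1r.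
rewrite -[leLHS]ger0_norm// -sqrtr_sqr ler_wsqrtr// -natrX ler_nat.
exact: leq_mfact_mdouble.
Qed.

(** Splitting the sign and the power of 2 over k + n separates the prefactor of [bcoef] from the
    summand of [bterm]. *)
Lemma weight_madd d (k n : mindex d) :
  mbinom_k32 R k * weight R (madd k n) = ((-1) ^+ mabs n * 2 ^+ mabs n) *
  (mbinom_k32 R k * (-1) ^+ mabs k * 2 ^+ mabs k * (mfact (madd k n))%:R
     / Num.sqrt (mfact (mdouble (madd k n)))%:R).
Proof. by rewrite /weight mabs_madd !exprD; ring. Qed.

Lemma bterm_le d (f : ('I_d -> R) -> R[i]) (n k : mindex d) :
  modc (bterm f n k) <= 2 ^+ mabs k * modc (hermite_coef f (mdouble (madd k n))).
Proof.
rewrite /bterm modcM modcR ler_wpM2r ?modc_ge0//.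
have -> : `|mbinom_k32 R k * (-1) ^+ mabs k * 2 ^+ mabs k * (mfact (madd k n))%:R
     / Num.sqrt (mfact (mdouble (madd k n)))%:R| =
  `|mbinom_k32 R k| * (2 ^+ mabs k * (`|weight R (madd k n)| / 2 ^+ mabs (madd k n))).
  rewrite /weight !normrM !normrX normrN1 !expr1n normr_nat.
  by field; rewrite ?expf_neq0 ?gt_eqF ?normr_gt0 ?gt_eqF ?sqrtr_gt0 ?ltr0n ?mfact_gt0.
rewrite -[leRHS]mul1r ler_pM ?mbinom_le1 ?mulr_ge0 ?exprn_ge0 ?invr_ge0 ?exprn_ge0//.
by rewrite ler_piMr ?exprn_ge0// ler_pdivrMr ?exprn_gt0// mul1r weight_le.
Qed.

Lemma pi_powR_ge1 d : 1 <= pi `^ (d%:R / 4) :> R.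
Proof.
have pi1 : 1 <= pi :> R by have := pi_ge2 R; lra.
by rewrite -[leLHS](powRr0 pi); apply: ler_powR => //; rewrite divr_ge0.
Qed.

(** A single constant [C] per [n] controls the summation over k and carries the decay in n. *)
Lemma bterm_geo d sigma (f : ('I_d -> R) -> R[i]) : 0 < sigma ->
  lflat sigma (hermite_coef f) ->
  exists h, 0 < h /\ exists M, forall n : mindex d, exists C,
    (forall k, modc (bterm f n k) <= C * 4^-1 ^+ mabs k) /\
    C * h ^+ mabs n * (mfact n)%:R `^ sigma^-1 <= M.
Proof.
move=> s0 /(lflat_shift s0)[h [h0 [M hM]]]; exists h; split=> //; exists M => n.
have F0 : 0 < (mfact n)%:R `^ sigma^-1 :> R by rewrite powR_gt0// ltr0n mfact_gt0.
have H0 : 0 < h ^+ mabs n by rewrite exprn_gt0.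
exists (M / (h ^+ mabs n * (mfact n)%:R `^ sigma^-1)); split; last first.
  by rewrite -mulrA divfK// gt_eqF// mulr_gt0.
move=> k; apply: le_trans (bterm_le f n k) _.
have := hM n k; rewrite -mulrA -ler_pdivlMr ?mulr_gt0//.
move: (M / _) (modc _) => C u hu.
have -> : 2 ^+ mabs k * u = u * 8 ^+ mabs k * 4^-1 ^+ mabs k.
  by rewrite -mulrA -exprMn (_ : 8 * 4^-1 = 2 :> R) 1?mulrC//; field.
by rewrite ler_wpM2r// exprn_ge0// invr_ge0.
Qed.

Lemma lflat_bcoef d sigma (f : ('I_d -> R) -> R[i]) : 0 < sigma ->
  lflat sigma (hermite_coef f) -> lflat (sigma / 2) (bcoef f).
Proof.
move=> s0 /(bterm_geo s0)[h [h0 [M hM]]].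
(* Halving [h] absorbs the prefactor 2^|n| of [bcoef]. *)
exists (h / 2); split; first by rewrite divr_gt0.
exists (M * 2 ^+ d) => n; rewrite -/(modc _).
have [C [hC hCM]] := hM n; have [y hy _] := box_sum_cvg hC.
have yle : modc y <= C * 2 ^+ d.
  rewrite -[y]subr0; apply: (cvg_modc_le hy); exists 0%N => // N _.
  by rewrite subr0; exact: modc_box_sum_le.
rewrite /bcoef (msumE hy) modcM modcR !normrM !normrX normrN1 expr1n mul1r normr_nat.
rewrite normfV (ger0_norm (powR_ge0 _ _)).
have -> : 2 * (sigma / 2) = sigma by field.
rewrite expr_div_n; have := pi_powR_ge1 d.
have : 0 < (mfact n)%:R `^ sigma^-1 :> R by rewrite powR_gt0// ltr0n mfact_gt0.
have := exprn_gt0 (mabs n) h0; have t0 : 0 < 2 ^+ mabs n :> R by rewrite exprn_gt0.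
move: hCM; move: (_ `^ sigma^-1) (h ^+ _) (2 ^+ mabs n) t0 (pi `^ _) => F H T T0 p hCM H0 F0 p1.
have p0 : 0 < p by lra.
rewrite (_ : _ * F = p^-1 * (modc y * (H * F))); last by field; rewrite !gt_eqF.
apply: (@le_trans _ _ (modc y * (H * F))).
  by rewrite ler_piMl ?invf_le1// !mulr_ge0 ?modc_ge0 ?ltW.
apply: (@le_trans _ _ (C * 2 ^+ d * (H * F))).
  by rewrite ler_wpM2r// mulr_ge0 ?ltW.
rewrite (_ : _ * _ = C * H * F * 2 ^+ d); last by ring.
by rewrite ler_wpM2r// exprn_ge0.
Qed.

End Expansion.

Theorem theorem6p5 (R : realType) (d : nat) (sigma : R)
    (f : ('I_d -> R) -> R[i]) :
  0 < sigma ->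
  Hflat_even sigma f ->
  Gflat sigma (fun x => f (wmap x)) /\
  (forall n : mindex d, msummable (bterm f n)) /\
  lflat sigma (bcoef f) /\
  (forall x, pos_orthant x ->
     msum_to (fun n => bcoef f n * (laguerre_d n x)%:C) (f (wmap x))).
Proof.
move=> s0 [[a [ha haf]] ef].
have hf x := (haf x).2.
have [M24 h24] := lflat_geo s0 (ltac:(by rewrite invr_gt0) : 0 < 24^-1 :> R) ha.
have coefE : hermite_coef f = a by apply/funext => n; exact: hermite_coefE n h24 hf.
have a_odd := hermite_coef_even h24 hf ef.
have hcoef : lflat sigma (hermite_coef f) by rewrite coefE.
have [h [h0 [Mb hb]]] := bterm_geo s0 hcoef.
have s20 : 0 < sigma / 2 by rewrite divr_gt0.
have lb2 := lflat_bcoef s0 hcoef.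
have expansion x : pos_orthant x ->
    msum_to (fun n => bcoef f n * (laguerre_d n x)%:C) (f (wmap x)).
  move=> x0; split.
    have [M8 h8] := lflat_geo s20 (ltac:(by rewrite invr_gt0) : 0 < 8^-1 :> R) lb2.
    have [E E0 hE] := laguerre_d_le x0.
    apply: (@geo_msummable _ _ (M8 * E)) => n; rewrite modcM modcR.
    apply: le_trans (ler_pM (modc_ge0 _) (normr_ge0 _) (h8 n) (hE n)) _.
    rewrite (_ : 4^-1 = 8^-1 * 2 :> R); last by field.
    by rewrite exprMn le_eqVlt; apply/orP; left; apply/eqP; ring.
  have [M16 h16] := lflat_geo s0 (ltac:(by rewrite invr_gt0) : 0 < 16^-1 :> R) ha.
  pose p : R := pi `^ (d%:R / 4).
  have p0 : p != 0 by rewrite gt_eqF// (lt_le_trans _ (pi_powR_ge1 _ _)).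
  pose al m := (weight R m)%:C * a (mdouble m).
  (* This is [bcoef] without its power of pi, which is restored at the end through [p]. *)
  pose z n := ((-1) ^+ mabs n * 2 ^+ mabs n)%:C * Defs.msum (bterm f n).
  have M0 : 0 <= M16.
    have := le_trans (modc_ge0 _) (h16 [ffun=> 0%N]).
    by rewrite pmulr_lge0// exprn_gt0// invr_gt0.
  (* The weight costs 2^|m| and doubling the index squares the ratio: 2 / 16^2 <= 1 / 64. *)
  have hal m : modc (al m) <= M16 * 64^-1 ^+ mabs m.
    rewrite modcM modcR.
    apply: le_trans (ler_pM (normr_ge0 _) (modc_ge0 _) (weight_le _ m) (h16 _)) _.
    rewrite mabs_mdouble mulrCA ler_wpM2l// mulnC exprM -exprMn lerXn2r ?nnegrE//.
    by rewrite expr2; lra.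
  have hz n : box_sum (fun k => (mbinom_k32 R k)%:C * al (madd k n)) @ \oo --> z n.
    have [C [hC _]] := hb n; have [y hy _] := box_sum_cvg hC.
    rewrite /z (msumE hy).
    have -> : box_sum (fun k => (mbinom_k32 R k)%:C * al (madd k n)) =
        fun N => ((-1) ^+ mabs n * 2 ^+ mabs n)%:C * box_sum (bterm f n) N.
      apply/funext => N; rewrite !box_sumE mulr_sumr; apply: eq_bigr => k _.
      by rewrite /al mulrA -rmorphM weight_madd rmorphM /bterm coefE mulrA.
    exact: cvgMl_tmp.
  have hF : (fun N => \sum_(m <- box d N) al m * (\sum_(n <- box d N) laguerre_d n x *
      \sum_(k <- box d N | madd k n == m) mbinom_k32 R k)%:C) @ \oo -->
      p%:C * f (wmap x).
    (* Along boxes of even side, the vanishing of the odd coefficients leaves exactly the doubled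
       indices. *)
    have := cvg_double (hf (wmap x)).
    set u := (fun N => _); move=> hu.
    rewrite (_ : (fun N => _) = (fun N => p%:C * u N)); first exact: cvgMl_tmp.
    apply/funext => N; rewrite /u box_sum_double; last first.
      by move=> n j oj; rewrite (a_odd n j oj) mul0r.
    rewrite mulr_sumr big_seq [RHS]big_seq; apply: eq_bigr => m mN.
    rewrite (hermite_d_sqrt x0 mN) -/p /al.
    set S := \sum_(n <- _) _.
    rewrite mulrCA -rmorphM mulrAC -rmorphM [in RHS]mulrC; congr (_ * _).
    by congr (_%:C); field.
  have hzl := laguerre_rearrangement x0 hal hz hF.
  have -> : box_sum (fun n => bcoef f n * (laguerre_d n x)%:C) =
      fun N => (p^-1)%:C * box_sum (fun n => z n * (laguerre_d n x)%:C) N.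
    apply/funext => N; rewrite !box_sumE mulr_sumr; apply: eq_bigr => n _.
    by rewrite /z /bcoef !mulrA -rmorphM; congr (_%:C * _ * _); rewrite mulrC.
  rewrite (_ : f (wmap x) = (p^-1)%:C * (p%:C * f (wmap x))); first exact: cvgMl_tmp.
  by rewrite mulrA -rmorphM mulVf// mul1r.
split; first by exists (bcoef f).
split; last by split=> //; exact: lflat_half.
by move=> n; have [C [hC _]] := hb n; exact: geo_msummable hC.
Qed.
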